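(* Consider site percolation on the triangular lattice with parameter $p$, where $0<p\le 0.5$. Then there exists $\alpha>0$ such that for all integers $n\ge 1$, $$n^{\alpha}\le \mathbf{E}_p\left(N_n \,\middle|\, LR\left([-n,n]^2\right)\right),$$ where $N_n$ is the number of pivotal vertices in $[-n,n]^2$ for the left-right open crossing event $LR([-n,n]^2)$.
   Context: Triangular lattice: the vertex set is $\mathbf{Z}^2$, and the nearest neighbors of $(x,y)$ are $(x\pm1,y)$, $(x,y\pm1)$, $(x+1,y-1)$, $(x-1,y+1)$. Each vertex is open with probability $p$ and closed with probability $1-p$, independently of all others; $\mathbf{P}_p$ is the resulting product measure and $\mathbf{E}_p$ its expectation. A path is a finite sequence of distinct vertices in which consecutive vertices are nearest neighbors. The left, right, bottom and top sides of $[-n,n]^2$ are the sets of lattice vertices of $[-n,n]^2$ with first coordinate $-n$, first coordinate $n$, second coordinate $-n$, and second coordinate $n$, respectively. A left-right open crossing of $[-n,n]^2$ is a path $v_0,v_1,\dots,v_l$ in $[-n,n]^2$ with $v_0$ on the left side, $v_l$ on the right side, and all other vertices in $(-n,n)^2$ and open (no condition is imposed on the states of the endpoints $v_0,v_l$). $LR([-n,n]^2)$ is the event that such a crossing exists. A left-right crossing $\Gamma$ divides $[-n,n]^2$ into a top part and a bottom part, containing the top and the bottom side respectively; $T^\circ(\Gamma)$ and $B^\circ(\Gamma)$ denote these parts with the vertices of $\Gamma$ removed. For $v\in(-n,n)^2$, an open (resp. closed) arm from $v$ to a given side of $[-n,n]^2$ is a path starting at a neighbor of $v$, not containing $v$,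 and ending on that side, all of whose vertices except the final one lie in $(-n,n)^2$ and are open (resp. closed); no condition is imposed on the state of the final vertex. The vertex $v$ is pivotal (has four arm paths) if $v$ is open and there are two disjoint open arms $\Gamma_1$, $\Gamma_3$ from $v$ to the left and right sides respectively, so that $\Gamma=\Gamma_1\cup\{v\}\cup\Gamma_3$ is a left-right open crossing, together with a closed arm $\Gamma_2$ from $v$ to the bottom side contained in $B^\circ(\Gamma)$ and a closed arm $\Gamma_4$ from $v$ to the top side contained in $T^\circ(\Gamma)$. $N_n$ is the number of pivotal vertices (it depends on the configuration). *)

(* Defs.v *)
From HB Require Import structures.
From mathcomp Require Import all_boot all_order all_algebra finmap.
From mathcomp Require Import all_classical all_reals all_analysis.

Set Implicit Arguments.
Unset Strict Implicit.
Unset Printing Implicit Defensive.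

Import Order.TTheory GRing.Theory Num.Theory.

Local Open Scope classical_set_scope.
Local Open Scope ring_scope.

Definition vertex := (int * int)%type.

Definition nbr (u v : vertex) : bool :=
  (v.1 - u.1, v.2 - u.2) \in
    [:: (1, 0); (-1, 0); (0, 1); (0, -1); (1, -1); (-1, 1)].

(* [true] is open, [false] is closed. *)
Definition config := vertex -> bool.

Definition box (n : nat) (v : vertex) : bool :=
  (- n%:Z <= v.1 <= n%:Z) && (- n%:Z <= v.2 <= n%:Z).

Definition open_box (n : nat) (v : vertex) : bool :=
  (- n%:Z < v.1 < n%:Z) && (- n%:Z < v.2 < n%:Z).

Definition left_side n (v : vertex) : bool := box n v && (v.1 == - n%:Z).
Definition right_side n (v : vertex) : bool := box n v && (v.1 == n%:Z).
Definition bottom_side n (v : vertex) : bool := box n v && (v.2 == - n%:Z).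
Definition top_side n (v : vertex) : bool := box n v && (v.2 == n%:Z).

Definition is_path (s : seq vertex) : bool := uniq s && sorted nbr s.

(* The states of the two endpoints [a] and [b] are unconstrained. *)
Definition lr_open_crossing n (w : config) (s : seq vertex) : Prop :=
  exists a q b, [/\ s = a :: rcons q b, is_path s,
    left_side n a, right_side n b & all (fun u => open_box n u && w u) q].

Definition lr_event n : set config :=
  [set w | exists s, lr_open_crossing n w s].

(* Vertices of the box that are connected to [side] by a lattice path of the
   box avoiding [g].  As [g] need not be an induced path, it may enclose
   vertices that it separates from both the top and the bottom side in the
   lattice; no arm ending on the top or bottom side and avoiding [g] visits
   such vertices. *)
Definition part n (side : pred vertex) (g : seq vertex) (u : vertex) : Prop :=
  exists s, [/\ is_path (u :: s), side (last u s) &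
    all (fun x => box n x && (x \notin g)) (u :: s)].

Definition top_part n (g : seq vertex) : vertex -> Prop :=
  part n (top_side n) g.
Definition bottom_part n (g : seq vertex) : vertex -> Prop :=
  part n (bottom_side n) g.

(* [s] is an arm from [v], which is not itself listed in [s]; the state of the
   final vertex [b] is unconstrained. *)
Definition arm n (state : pred vertex) (side : pred vertex) (v : vertex)
    (s : seq vertex) : Prop :=
  exists q b, [/\ s = rcons q b, is_path (v :: s), side b &
    all (fun u => open_box n u && state u) q].

Definition open_arm n (w : config) := arm n (fun u => w u).
Definition closed_arm n (w : config) := arm n (fun u => ~~ w u).

Definition pivotal n (w : config) (v : vertex) : Prop :=
  open_box n v /\ w v /\
  exists g1 g2 g3 g4 : seq vertex,
    let g := rev g1 ++ v :: g3 in
    [/\ open_arm n w (left_side n) v g1,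
        open_arm n w (right_side n) v g3,
        (forall u, u \in g1 -> u \notin g3) /\ lr_open_crossing n w g,
        closed_arm n w (bottom_side n) v g2 /\
          (forall u, u \in g2 -> bottom_part n g u) &
        closed_arm n w (top_side n) v g4 /\
          (forall u, u \in g4 -> top_part n g u)].

(* This set is finite, being contained in the open box, so that [fset_set] does
   not fall back to its default value. *)
Definition num_pivotal n (w : config) : nat :=
  #|` fset_set [set v | pivotal n w v] |.

Section Probability.
Context d (Omega : measurableType d) (R : realType) (P : probability Omega R).

Definition independent_events (I : choiceType) (E : I -> set Omega) : Prop :=
  forall J : {fset I},
    P (\bigcap_(i in [set` J]) E i) = (\prod_(i <- J) P (E i))%E.

(* The law of such an [X] is the Bernoulli([p]) product measure on [config]. *)
Definition site_percolation (p : R) (X : Omega -> config) : Prop :=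
  [/\ forall v, measurable [set o | X o v],
      forall v, P [set o | X o v] = p%:E &
      independent_events (fun v : vertex => [set o | X o v])].

Definition cond_expectation (Y : Omega -> R) (A : set Omega) : \bar R :=
  ('E_P[Y \* \1_A] / P A)%E.

End Probability.

(* Main.v *)
Require Import Defs.
From mathcomp Require Import all_boot all_order all_algebra finmap.
From mathcomp Require Import all_classical all_reals all_analysis.
From mathcomp Require Import measurable_realfun.
From mathcomp Require Import zify ring lra.

(* Write [F] for the probability of a crossing.  By planar duality, an open
   vertex whose closing destroys all crossings is pivotal, so [E(N; LR)] is at
   least [p] times the total influence.  Exploring the open clusters of the
   vertices of a column [k] decides whether there is a crossing, and the
   inequality of O'Donnell, Saks, Schramm and Servedio gives
   [F (1 - F) <= p (1 - p) sum_u delta_k(u) Inf(u)], where [delta_k(u)] is the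
   probability that [u] is examined.  Averaging over [k], and using [F <= p]
   (a consequence of self-duality at [1/2]), one gets [E(N | LR) >= 1 / delta]
   where [delta] bounds the mean over [k] of [delta_k(u)].  If [u] is examined
   then a neighbour of [u] has an open arm up to the column [k], so a polynomial
   upper bound for arm probabilities at [p = 1/2] suffices when [n] is large,
   while [delta < 1] is enough for the remaining [n >= 2].

   The arm bound follows from the existence, with probability bounded below, of
   closed barriers in disjoint annuli.  These are built by repeatedly doubling
   the length of a rectangle: explore the lowest crossing of the left half,
   reflect it, and use that by symmetry and duality it is joined with
   probability at least 1/2 to the right half of the top or to the right side. *)

Set Implicit Arguments.
Unset Strict Implicit.
Unset Printing Implicit Defensive.

Import Order.TTheory GRing.Theory Num.Theory.
Import numFieldNormedType.Exports.
Local Open Scope classical_set_scope.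
Local Open Scope ring_scope.

(** * Product measure on configurations *)

Section Averaging.
Variables (T : eqType) (R : realFieldType).
Implicit Types (w : T -> bool) (f g : (T -> bool) -> R) (p : R) (s D : seq T).

Definition upd w (v : T) (b : bool) : T -> bool :=
  fun u => if u == v then b else w u.

Lemma updC w u v b c : u != v -> upd (upd w u b) v c = upd (upd w v c) u b.
Proof.
move=> uv; apply: funext => x; rewrite /upd.
by case: eqVneq => // ->; rewrite eq_sym (negbTE uv).
Qed.

Lemma updK w v b c : upd (upd w v b) v c = upd w v c.
Proof. by apply: funext => x; rewrite /upd; case: eqP. Qed.

Lemma upd_same w v b : upd w v b v = b.
Proof. by rewrite /upd eqxx. Qed.

Lemma upd_id w v : upd w v (w v) = w.
Proof. by apply: funext => x; rewrite /upd; case: eqP => // ->. Qed.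

Definition avg1 p v f : (T -> bool) -> R :=
  fun w => p * f (upd w v true) + (1 - p) * f (upd w v false).

(* For [f] depending only on sites of [s], [avg p s f w] does not depend on [w]:
   it is the expectation of [f] under the Bernoulli([p]) product measure. *)
Definition avg p s f := foldr (avg1 p) f s.

Definition indep v f := forall w b, f (upd w v b) = f w.
Definition supported D f := forall w w', {in D, w =1 w'} -> f w = f w'.
Definition incr f :=
  forall w w', (forall v, w v -> w' v) -> f w <= f w'.

Lemma supported_indep D f v : supported D f -> v \notin D -> indep v f.
Proof.
move=> sf vD w b; apply: sf => u uD; rewrite /upd; case: eqP => // uv.
by rewrite uv (negbTE vD) in uD.
Qed.

Lemma supportedS D D' f : {subset D <= D'} -> supported D f -> supported D' f.
Proof. by move=> DD sf w w' ww; apply: sf => u /DD/ww. Qed.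

Lemma avg1_indep p v f : indep v f -> avg1 p v f = f.
Proof. by move=> vf; apply: funext => w; rewrite /avg1 !vf; ring. Qed.

Lemma indep_avg1 p v f : indep v (avg1 p v f).
Proof. by move=> w b; rewrite /avg1 !updK. Qed.

Lemma avg1C p u v f : avg1 p u (avg1 p v f) = avg1 p v (avg1 p u f).
Proof.
have [->//|uv] := eqVneq u v.
apply: funext => w; rewrite /avg1 !(updC w _ _ uv); ring.
Qed.

Lemma indep_avg1_other p u v f : indep u f -> indep u (avg1 p v f).
Proof.
move=> uf w b; rewrite /avg1; have [->|uv] := eqVneq u v; first by rewrite !updK.
by rewrite !(updC w _ _ uv) !uf.
Qed.

Lemma avg_avg1C p v s f : avg p s (avg1 p v f) = avg1 p v (avg p s f).
Proof. by elim: s => //= u s ->; rewrite avg1C. Qed.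

Lemma avgC p s t f : avg p s (avg p t f) = avg p t (avg p s f).
Proof. by elim: s => //= u s ->; rewrite avg_avg1C. Qed.

Lemma indep_avg_mem p v s f : v \in s -> indep v (avg p s f).
Proof.
elim: s => //= u s IH; rewrite in_cons => /orP[/eqP->|/IH]; first exact: indep_avg1.
exact: indep_avg1_other.
Qed.

Lemma avg_absorb p t s f : {subset t <= s} -> avg p s (avg p t f) = avg p s f.
Proof.
rewrite avgC; elim: t => //= v t IH ts; rewrite IH.
  by apply: avg1_indep; apply: indep_avg_mem; apply: ts; rewrite mem_head.
by move=> u ut; apply: ts; rewrite in_cons ut orbT.
Qed.

Lemma avg_indep p s f : {in s, forall v, indep v f} -> avg p s f = f.
Proof.
elim: s => //= v s IH H; rewrite IH; last first.
  by move=> u us; apply: H; rewrite in_cons us orbT.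
by apply: avg1_indep; apply: H; rewrite mem_head.
Qed.

Lemma supported_avg p D s f :
  supported D f -> supported [seq v <- D | v \notin s] (avg p s f).
Proof.
elim: s => [|v s IH] sf /=.
  by move=> w w' ww; apply: sf => u uD; apply: ww; rewrite mem_filter uD.
move=> w w' ww; rewrite /avg1; congr (_ * _ + _ * _); apply: IH => // u;
  rewrite mem_filter => /andP[us uD]; rewrite /upd; case: eqVneq => // uv;
  by apply: ww; rewrite mem_filter in_cons negb_or uv us.
Qed.

Lemma avg_const p D s f w w' : supported D f -> {subset D <= s} ->
  avg p s f w = avg p s f w'.
Proof.
move=> sf Ds; have := @supported_avg p D s f sf; apply => u.
by rewrite mem_filter => /andP[us /Ds]; rewrite (negbTE us).
Qed.

Lemma avg_cst p s c : avg p s (fun _ => c) = (fun _ => c).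
Proof. exact: avg_indep. Qed.

Lemma avg_change p D s t f w w' : supported D f -> {subset D <= s} ->
  {subset D <= t} -> avg p s f w = avg p t f w'.
Proof.
move=> sf Ds Dt.
have -> : avg p t f = fun _ => avg p t f w'.
  by apply: funext => x; apply: (avg_const _ _ _ sf Dt).
have E u : avg p s (avg p t f) u = avg p t f w'.
  have -> : avg p t f = fun _ => avg p t f w'.
    by apply: funext => x; apply: (avg_const _ _ _ sf Dt).
  by rewrite avg_cst.
rewrite -(E w) avgC.
have -> : avg p s f = fun _ => avg p s f w.
  by apply: funext => x; apply: (avg_const _ _ _ sf Ds).
by rewrite avg_cst.
Qed.

Lemma avgD p s f g w :
  avg p s (fun w => f w + g w) w = avg p s f w + avg p s g w.
Proof.
elim: s w => //= v s IH w.
by rewrite {1}/avg1 !IH /avg1; ring.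
Qed.

Lemma avgZ p s (c : R) f w : avg p s (fun w => c * f w) w = c * avg p s f w.
Proof. by elim: s w => //= v s IH w; rewrite {1}/avg1 !IH /avg1; ring. Qed.

Lemma avg_sum p s (I : Type) (r : seq I) (P : pred I) (F : I -> (T -> bool) -> R) w :
  avg p s (fun w => \sum_(i <- r | P i) F i w) w =
  \sum_(i <- r | P i) avg p s (F i) w.
Proof.
elim: r => [|i r IH].
  rewrite big_nil; under [X in avg _ _ X]funext => x do rewrite big_nil.
  by rewrite avg_cst.
under [X in avg _ _ X]funext => x do rewrite big_cons.
by rewrite big_cons; case: (P i) => //; rewrite avgD IH.
Qed.

Lemma avgMl p s f g : {in s, forall v, indep v f} ->
  avg p s (fun w => f w * g w) = fun w => f w * avg p s g w.
Proof.
elim: s => //= v s IH H; rewrite IH; last first.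
  by move=> u us; apply: H; rewrite in_cons us orbT.
apply: funext => w; rewrite /avg1 !(H v) ?mem_head //; ring.
Qed.

Lemma avg_prod p s D D' f g w : supported D f -> supported D' g ->
  {subset D' <= s} -> {in D, forall v, v \notin D'} ->
  avg p s (fun w => f w * g w) w = avg p s f w * avg p s g w.
Proof.
move=> sf sg D's DD'.
rewrite -(avg_absorb p (fun w => f w * g w) D's) avgMl; last first.
  by move=> v vD'; apply: (supported_indep sf); apply: contraL vD'; apply: DD'.
have -> : avg p D' g = fun _ => avg p s g w.
  by apply: funext => x; apply: (avg_change _ _ _ sg).
by under [X in avg _ _ X]funext => x do rewrite mulrC; rewrite avgZ mulrC.
Qed.

Section Monotone.
Variable p : R.
Hypothesis p01 : 0 <= p <= 1.

Lemma avg_le s f g : (forall w, f w <= g w) -> forall w, avg p s f w <= avg p s g w.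
Proof.
case/andP: p01 => p0 p1; move=> fg; elim: s => //= v s IH w; rewrite /avg1.
by apply: lerD; apply: ler_wpM2l => //; rewrite subr_ge0.
Qed.

Lemma avg_ge0 s f w : (forall w, 0 <= f w) -> 0 <= avg p s f w.
Proof. by move=> f0; rewrite -[X in X <= _](congr1 (@^~ w) (avg_cst p s 0)); apply: avg_le. Qed.

Lemma avg_le1 s f w : (forall w, f w <= 1) -> avg p s f w <= 1.
Proof. by move=> f0; rewrite -[X in _ <= X](congr1 (@^~ w) (avg_cst p s 1)); apply: avg_le. Qed.

Lemma incr_avg1 v f : incr f -> incr (avg1 p v f).
Proof.
case/andP: p01 => p0 p1; move=> incf w w' ww; rewrite /avg1.
apply: lerD; apply: ler_wpM2l; rewrite ?subr_ge0 //; apply: incf => u;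
  by rewrite /upd; case: eqP => // _; apply: ww.
Qed.

Lemma incr_avg s f : incr f -> incr (avg p s f).
Proof. by move=> incf; elim: s => //= v s; apply: incr_avg1. Qed.

Lemma incr_upd f w v : incr f -> f (upd w v false) <= f (upd w v true).
Proof. by move=> incf; apply: incf => u; rewrite /upd; case: eqP. Qed.

Lemma harris s f g w : incr f -> incr g ->
  avg p s f w * avg p s g w <= avg p s (fun w => f w * g w) w.
Proof.
case/andP: p01 => p0 p1 incf incg; elim: s w => //= v s IH w.
pose h w := avg p s f w * avg p s g w.
apply: (@le_trans _ _ (avg1 p v h w)).
  have Hf := incr_upd w v (incr_avg s incf).
  have Hg := incr_upd w v (incr_avg s incg).
  rewrite /h /avg1 -subr_ge0.
  set a := avg _ _ _ _ in Hf *; set b := avg _ _ _ _ in Hf *.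
  set c := avg _ _ _ _ in Hg *; set d := avg _ _ _ _ in Hg *.
  have -> : p * (b * d) + (1 - p) * (a * c) -
    (p * b + (1 - p) * a) * (p * d + (1 - p) * c) =
    p * (1 - p) * ((b - a) * (d - c)) by ring.
  by rewrite !mulr_ge0 // subr_ge0.
by rewrite /avg1 /h; apply: lerD; apply: ler_wpM2l; rewrite ?subr_ge0.
Qed.

End Monotone.

Lemma avg_le_param p q s f w : 0 <= p -> p <= q -> q <= 1 -> incr f ->
  avg p s f w <= avg q s f w.
Proof.
move=> p0 pq q1 incf; elim: s w => //= v s IH w.
have H := incr_upd w v (incr_avg (p := q) _ s incf).
apply: (@le_trans _ _ (avg1 p v (avg q s f) w)).
  by rewrite /avg1; apply: lerD; apply: ler_wpM2l => //; lra.
rewrite /avg1; have {}H := H ltac:(by rewrite (le_trans p0 pq) q1).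
by nra.
Qed.

(* The logit of the probability of an increasing event grows at least as fast as
   the logit of [p]. *)
Lemma avg_half_le p s f w : 0 < p -> p <= 1 / 2 -> incr f ->
  (forall w, f w = 0 \/ f w = 1) -> avg (1 / 2) s f w <= 1 / 2 -> avg p s f w <= p.
Proof.
move=> p0 p12 incf f01.
have h01 : 0 <= 1 / 2 :> R /\ 1 / 2 <= 1 :> R by lra.
pose phi (x : R) := p * x / ((1 - p) - (1 - 2 * p) * x).
have den x : 0 <= x <= 1 -> 0 < (1 - p) - (1 - 2 * p) * x.
  by case/andP=> *; nra.
have key x : avg p s f x <= phi (avg (1 / 2) s f x).
  elim: s x => [|v s IH] x /=.
    rewrite /phi; case: (f01 x) => ->; first by rewrite mulr0 mul0r.
    by rewrite ler_pdivlMr; [lra | lra].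
  have H := @incr_upd f.
  have := incr_upd x v (incr_avg (p := 1 / 2) _ s incf).
  have Hge y : 0 <= avg (1 / 2) s f y by apply: avg_ge0 => [|z]; [lra | case: (f01 z) => ->; lra].
  have Hle y : avg (1 / 2) s f y <= 1 by apply: avg_le1 => [|z]; [lra | case: (f01 z) => ->; lra].
  rewrite /avg1; move: (IH (upd x v true)) (IH (upd x v false)).
  move: (Hge (upd x v true)) (Hge (upd x v false)) (Hle (upd x v true)) (Hle (upd x v false)).
  set a' := avg p s f _; set b' := avg p s f _.
  set a := avg _ s f _; set b := avg _ s f _ => a0 b0 a1 b1 Ha Hb ba.
  have {}ba : b <= a by apply: ba; lra.
  apply: (@le_trans _ _ (p * phi a + (1 - p) * phi b)).
    by apply: lerD; apply: ler_wpM2l => //; lra.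
  rewrite /phi.
  have da := den a ltac:(lra); have db := den b ltac:(lra).
  have dm := den (1 / 2 * a + (1 - 1 / 2) * b) ltac:(lra).
  have -> : p * (p * a / (1 - p - (1 - 2 * p) * a)) +
      (1 - p) * (p * b / (1 - p - (1 - 2 * p) * b)) =
      p * (1 / 2 * a + (1 - 1 / 2) * b) / (1 - p - (1 - 2 * p) * (1 / 2 * a + (1 - 1 / 2) * b))
      - p * ((1 - 2 * p) * (a - b) / 2 * (1 - p) *
         (1 - p - (1 - 2 * p) * (1 / 2 * a + (1 - 1 / 2) * b) - (a - b) / 2)) /
        ((1 - p - (1 - 2 * p) * a) * (1 - p - (1 - 2 * p) * b) *
         (1 - p - (1 - 2 * p) * (1 / 2 * a + (1 - 1 / 2) * b))).
    by field; rewrite !gt_eqF //; apply: lt_le_trans dm _; lra.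
  rewrite gerBl; apply: divr_ge0; last by rewrite !mulr_ge0 // ltW.
  apply: mulr_ge0; first lra.
  apply: mulr_ge0; last by nra.
  by rewrite !mulr_ge0 //; lra.
move=> fh; apply: le_trans (key w) _.
have x0 : 0 <= avg (1 / 2) s f w by apply: avg_ge0 => [|z]; [lra | case: (f01 z) => ->; lra].
rewrite /phi ler_pdivrMr; last by apply: den; lra.
by rewrite ler_pM2l //; nra.
Qed.

End Averaging.

Section Symmetry.
Variables (T : eqType) (R : realFieldType).
Implicit Types (w : T -> bool) (f g h : (T -> bool) -> R) (p : R) (s D : seq T).

Definition negc w : T -> bool := fun v => ~~ w v.

Lemma negc_upd w v b : negc (upd w v b) = upd (negc w) v (~~ b).
Proof. by apply: funext => u; rewrite /negc /upd; case: eqP. Qed.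

Lemma avg_negc s f w :
  avg (1 / 2) s (fun w => f (negc w)) w = avg (1 / 2) s f (negc w).
Proof.
elim: s w => //= v s IH w; rewrite /avg1 !IH !negc_upd /=; lra.
Qed.

Lemma avg_bij p (sigma tau : T -> T) s f w :
  cancel sigma tau -> cancel tau sigma ->
  avg p s (fun w => f (w \o sigma)) w = avg p (map tau s) f (w \o sigma).
Proof.
move=> st ts; elim: s w => //= v s IH w.
have E b : upd w v b \o sigma = upd (w \o sigma) (tau v) b.
  by apply: funext => u; rewrite /upd /= -(inj_eq (can_inj ts)) st -(inj_eq (can_inj st)) ts.
by rewrite /avg1 !IH !E.
Qed.

(* The set [k w] of explored sites is determined by the states of its own
   sites, so given [k w] the other sites of [s] are still independent. *)
Lemma avg_explore p (k : (T -> bool) -> pred T) s g h (c : R) w :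
  0 <= p <= 1 ->
  (forall w w', {in [seq v <- s | k w v], w =1 w'} -> {in s, k w' =1 k w}) ->
  (forall w, c * h w <= avg p [seq v <- s | ~~ k w v] g w) ->
  c * avg p s h w <= avg p s g w.
Proof.
move=> p01 kself H.
pose I (m : (size s).-tuple bool) w : R := (map (k w) s == m)%:R.
pose kc (m : (size s).-tuple bool) := mask (map negb m) s.
have sumI x : \sum_m I m x = 1.
  rewrite (bigD1 (map_tuple (k x) (in_tuple s))) //= /I eqxx big1 ?addr0 // => m.
  by rewrite eq_sym -val_eqE /= => /negbTE ->.
have kcE (m : (size s).-tuple bool) x : map (k x) s = m -> kc m = [seq v <- s | ~~ k x v].
  by move=> Em; rewrite /kc -Em -map_comp filter_mask.
have kupd (m : (size s).-tuple bool) x v b : v \in kc m -> map (k x) s = m -> map (k (upd x v b)) s = m.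
  move=> vm Em; rewrite -Em; apply/eq_in_map; apply: kself => u.
  rewrite mem_filter => /andP[ku us]; rewrite /upd; case: eqP => // uv.
  by move: vm; rewrite (kcE _ _ Em) -uv mem_filter ku.
have indI m : {in kc m, forall v, indep v (I m)}.
  move=> v vm x b; rewrite /I; congr (_%:R); congr nat_of_bool.
  apply/eqP/eqP => [E|]; last exact: kupd.
  by rewrite -(upd_id x v) -(updK x v b); apply: kupd.
have split_avg f : avg p s f w = \sum_m avg p s (fun x => I m x * avg p (kc m) f x) w.
  transitivity (avg p s (fun x => \sum_m (fun x => I m x * f x) x) w).
    by congr avg; apply: funext => x; rewrite -mulr_suml sumI mul1r.
  rewrite avg_sum; apply: eq_bigr => m _.
  rewrite -(@avg_absorb _ _ _ (kc m) s); first by rewrite avgMl.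
  by move=> u /mem_mask.
rewrite [avg p s g w]split_avg.
apply: (@le_trans _ _ (\sum_m avg p s (fun x => I m x * (c * h x)) w)).
  rewrite -avg_sum -avgZ; apply: avg_le => // x.
  by rewrite -mulr_suml sumI mul1r.
apply: ler_sum => m _; apply: avg_le => // x.
rewrite /I; case: eqP => [/kcE ->|_]; last by rewrite !mul0r.
by rewrite !mul1r.
Qed.

End Symmetry.

Section DecisionTree.
Variables (T : eqType) (R : realFieldType) (p : R).
Hypothesis p01 : 0 <= p <= 1.
Implicit Types (w : T -> bool) (f g h : (T -> bool) -> R) (s D : seq T).

Inductive dtree := Leaf of bool | Query of T & dtree & dtree.

Fixpoint value t w : bool :=
  match t with
  | Leaf b => b
  | Query v t1 t0 => if w v then value t1 w else value t0 w
  end.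

Fixpoint queried t w : seq T :=
  match t with
  | Leaf _ => [::]
  | Query v t1 t0 => v :: (if w v then queried t1 w else queried t0 w)
  end.

Fixpoint sites t : seq T :=
  match t with Leaf _ => [::] | Query v t1 t0 => v :: sites t1 ++ sites t0 end.

Fixpoint read_once t : bool :=
  match t with
  | Leaf _ => true
  | Query v t1 t0 => [&& v \notin sites t1, v \notin sites t0, read_once t1 & read_once t0]
  end.

Definition influence s g v w : R :=
  avg p s (fun w => `|g (upd w v true) - g (upd w v false)|) w.

Lemma value_supported t w w' : {in sites t, w =1 w'} -> value t w = value t w'.
Proof.
elim: t => //= v t1 IH1 t0 IH0 H.
rewrite H ?mem_head // IH1 ?IH0 // => u ut; apply: H;
  by rewrite in_cons mem_cat ut ?orbT.
Qed.

Lemma queried_supported t w w' : {in sites t, w =1 w'} -> queried t w = queried t w'.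
Proof.
elim: t => //= v t1 IH1 t0 IH0 H.
rewrite H ?mem_head // IH1 ?IH0 // => u ut; apply: H;
  by rewrite in_cons mem_cat ut ?orbT.
Qed.

Lemma value_upd t v w b : v \notin sites t -> value t (upd w v b) = value t w.
Proof.
move=> vt; apply: value_supported => u ut; rewrite /upd; case: eqP => // uv.
by rewrite -uv ut in vt.
Qed.

Lemma queried_upd t v w b : v \notin sites t -> queried t (upd w v b) = queried t w.
Proof.
move=> vt; apply: queried_supported => u ut; rewrite /upd; case: eqP => // uv.
by rewrite -uv ut in vt.
Qed.

Lemma avg_absorb1 s v f w : v \in s -> avg p s (avg1 p v f) w = avg p s f w.
Proof.
move=> vs; rewrite -[avg1 p v f]/(avg p [:: v] f) avg_absorb // => u.
by rewrite inE => /eqP ->.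
Qed.

(* The inequality of O'Donnell, Saks, Schramm and Servedio.  Conditioning only
   the tree, but not [g], on the answer at the root makes the induction work. *)
Lemma osss s t g w : (forall w, 0 <= g w <= 1) -> uniq s ->
  read_once t -> {subset sites t <= s} -> (forall x y, avg p s g x = avg p s g y) ->
  avg p s (fun w => (value t w)%:R * g w) w -
    avg p s (fun w => (value t w)%:R) w * avg p s g w <=
  p * (1 - p) * \sum_(u <- s) avg p s (fun w => (u \in queried t w)%:R) w * influence s g u w.
Proof.
case/andP: (p01) => p0 p1 g01 us + + gcst.
have inf0 v : 0 <= influence s g v w by apply: avg_ge0.
elim: t => [b|v t1 IH1 t0 IH0] /= ro ss.
  rewrite avgZ avg_cst subrr mulr_ge0 ?subr_ge0 ?mulr_ge0 ?subr_ge0 //.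
  by apply: sumr_ge0 => u _; rewrite avg_cst mul0r.
have {ro} /and4P[v1 v0 ro1 ro0] := ro.
have {}IH1 := IH1 ro1 (fun u ut => ss u ltac:(by rewrite in_cons mem_cat ut orbT)).
have {}IH0 := IH0 ro0 (fun u ut => ss u ltac:(by rewrite in_cons mem_cat ut !orbT)).
have vs : v \in s by apply: ss; rewrite mem_head.
pose F1 x : R := (value t1 x)%:R; pose F0 x : R := (value t0 x)%:R.
have EF : avg p s (fun x => (if x v then value t1 x else value t0 x)%:R) w =
    p * avg p s F1 w + (1 - p) * avg p s F0 w.
  rewrite -[LHS](avg_absorb1 _ _ vs) -!avgZ -avgD; congr avg; apply: funext => x.
  by rewrite /avg1 !upd_same !value_upd.
pose G x := (F1 x - F0 x) * (g (upd x v true) - g (upd x v false)).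
have EFg : avg p s (fun x => (if x v then value t1 x else value t0 x)%:R * g x) w =
    p * avg p s (fun x => F1 x * g x) w + (1 - p) * avg p s (fun x => F0 x * g x) w
    + p * (1 - p) * avg p s G w.
  rewrite -[LHS](avg_absorb1 _ _ vs) -(@avg_absorb1 _ _ (fun y => F1 y * g y) w vs).
  rewrite -(@avg_absorb1 _ _ (fun y => F0 y * g y) w vs).
  rewrite -!avgZ -!avgD; congr avg; apply: funext => y.
  rewrite /avg1 !upd_same /G /F1 /F0 !value_upd //; ring.
have EQv u : avg p s (fun x => (u \in v :: (if x v then queried t1 x else queried t0 x))%:R) w
  = (u == v)%:R + (p * avg p s (fun x => (u \in queried t1 x)%:R) w
     + (1 - p) * avg p s (fun x => (u \in queried t0 x)%:R) w).
  rewrite -[LHS](avg_absorb1 _ _ vs) -!avgZ -avgD.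
  rewrite -[X in X + _](congr1 (@^~ w) (avg_cst p s (u == v)%:R)) -avgD.
  congr avg; apply: funext => y.
  rewrite /avg1 !upd_same !queried_upd // !in_cons.
  case: eqVneq => [->|_]; last by rewrite add0r.
  have nq t : v \notin sites t -> (v \in queried t y) = false.
    elim: t {IH1 IH0 v1 v0 ro1 ro0 ss F1 F0 EF G EFg} => //= z a IHa b IHb.
    rewrite in_cons mem_cat !negb_or => /and3P[vz va vb].
    by rewrite in_cons (negbTE vz); case: (y z); rewrite ?IHa ?IHb.
  by rewrite !nq //=; ring.
under [X in _ <= _ * X]eq_bigr => u _ do rewrite EQv mulrDl mulrDl -!mulrA.
rewrite !big_split /= -!mulr_sumr.
have -> : \sum_(u <- s) (u == v)%:R * influence s g u w = influence s g v w.
  rewrite (bigD1_seq v) //= eqxx mul1r big1 ?addr0 // => u /negbTE ->.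
  by rewrite mul0r.
have GI : avg p s G w <= influence s g v w.
  apply: avg_le => // x; apply: le_trans (ler_norm _) _.
  rewrite normrM ler_piMl // /F1 /F0.
  by case: (value t1 x); case: (value t0 x); rewrite ?subrr ?subr0 ?sub0r ?normrN ?normr1 ?normr0.
rewrite EF EFg.
set S1 := \sum_(i <- s) _ in IH1 *; set S0 := \sum_(i <- s) _ in IH0 *.
set a1 := avg p s (fun w => F1 w * g w) w.
set a0 := avg p s (fun w => F0 w * g w) w.
have {IH1} I1 : a1 - avg p s F1 w * avg p s g w <= p * (1 - p) * S1 by [].
have {IH0} I0 : a0 - avg p s F0 w * avg p s g w <= p * (1 - p) * S0 by [].
move: GI I1 I0; set A := avg p s G w; set B := avg p s F1 w; set C := avg p s F0 w.
set D := avg p s g w; set J := influence _ _ _ _ => GI I1 I0.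
have H1 := ler_wpM2l p0 I1.
have H0 := @ler_wpM2l _ (1 - p) ltac:(by rewrite subr_ge0) _ _ I0.
have H2 := @ler_wpM2l _ (p * (1 - p)) ltac:(by rewrite mulr_ge0 ?subr_ge0) _ _ GI.
by apply: le_trans (le_trans (lerD (lerD H1 H0) H2) _); rewrite le_eqVlt; apply/orP; left; apply/eqP; ring.
Qed.

End DecisionTree.

(** * Planarity *)

Section Connection.
Variables (T : eqType) (e : rel T).
Implicit Types (S : pred T) (u v x : T) (s : seq T).

Definition conn S u v : Prop := exists s, [/\ path e u s, last u s = v & all S (u :: s)].

Lemma conn_refl S u : S u -> conn S u u.
Proof. by move=> Su; exists [::]; rewrite /= Su. Qed.

Lemma conn_trans S u v x : conn S u v -> conn S v x -> conn S u x.
Proof.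
case=> s [ps <- /= /andP[Su Ss]] [t [pt <- /= /andP[_ St]]].
by exists (s ++ t); rewrite cat_path ps pt last_cat /= Su all_cat Ss St.
Qed.

Lemma conn1 S u v : S u -> S v -> e u v -> conn S u v.
Proof. by move=> Su Sv uv; exists [:: v]; rewrite /= uv Su Sv. Qed.

Lemma conn_start S u v : conn S u v -> S u.
Proof. by case=> s [_ _ /= /andP[]]. Qed.

Lemma conn_end S u v : conn S u v -> S v.
Proof. by case=> s [_ <- /allP]; apply; apply: mem_last. Qed.

Lemma conn_sub S S' u v : (forall x, S x -> S' x) -> conn S u v -> conn S' u v.
Proof. by move=> SS [s [ps sv Ss]]; exists s; split=> //; apply: sub_all Ss. Qed.

Lemma conn_sym S u v : symmetric e -> conn S u v -> conn S v u.
Proof.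
move=> es [s [ps <- Ss]]; exists (rev (belast u s)); split.
- by rewrite rev_path (eq_path (e' := e)) // => x y; apply: es.
- by case: s {ps Ss} => //= a s; rewrite rev_cons last_rcons.
- rewrite -rev_rcons -lastI all_rev; exact: Ss.
Qed.

Lemma conn_split S (Q : pred T) u v : conn S u v -> Q u -> ~~ Q v ->
  exists x y, [/\ conn S u x, Q x, e x y & conn (fun z => S z && ~~ Q z) y v].
Proof.
case=> s [ps sv Ss] Qu Qv.
suff [/= /andP[/negP]//|//] : all (predC Q) (u :: s) \/
  exists x y, [/\ conn S u x, Q x, e x y & conn (fun z => S z && ~~ Q z) y v].
elim: s u ps sv Ss {Qu} => [|a s IH] u /=; first by move=> _ ->; rewrite Qv; left.
move=> /andP[ua ps] sv /and3P[Su Sa Ss].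
have [|nQ|[x [y [ax Qx xy yv]]]] := IH a ps sv; first by rewrite /= Sa.
  case: (boolP (Q u)) => Qu; last by left; rewrite /= in nQ *.
  right; exists u, a; split=> //; first exact: conn_refl.
  exists s; split=> //; apply/allP => z zs.
  have /= -> := allP nQ z zs; rewrite andbT.
  by move: z zs; apply/allP; rewrite /= Sa.
by right; exists x, y; split=> //; apply: conn_trans ax; apply: conn1.
Qed.

End Connection.

Definition gadj (dg : int -> bool) (u v : vertex) : bool :=
  [|| (u.1 == v.1) && ((v.2 == u.2 + 1) || (u.2 == v.2 + 1)),
      (v.1 == u.1 + 1) && ((v.2 == u.2) || (v.2 == u.2 + (if dg u.1 then -1 else 1)))
    | (u.1 == v.1 + 1) && ((v.2 == u.2) || (u.2 == v.2 + (if dg v.1 then -1 else 1)))].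

Lemma gadj_sym dg : symmetric (gadj dg).
Proof.
move=> u v; rewrite /gadj [v.1 == u.1]eq_sym [v.2 == u.2]eq_sym.
by rewrite [(v.1 == u.1 + 1) && _ || _]orbC; congr (_ && _ || _); rewrite orbC.
Qed.

Definition rect (x0 x1 y0 y1 : int) (v : vertex) : bool :=
  (x0 <= v.1 <= x1) && (y0 <= v.2 <= y1).

Section Sperner.

(* Three labels: [Some true], [Some false] and [None]. *)
Definition bichrome (l l' : option bool) : bool :=
  match l, l' with Some a, Some b => a != b | _, _ => false end.

Lemma addb_tele (F : nat -> bool) b :
  \big[addb/false]_(0 <= j < b) (F j (+) F j.+1) = F 0%N (+) F b.
Proof.
elim: b => [|b IH]; first by rewrite big_geq // addbb.
by rewrite big_nat_recr //= IH -addbA (addbA (F b)) addbb.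
Qed.

Lemma sperner (L : nat -> nat -> option bool) (a b : nat) :
  let h i j := bichrome (L i j) (L i.+1 j) in
  let v i j := bichrome (L i j) (L i j.+1) in
  (forall i j, (i < a)%N -> (j < b)%N ->
     h i j (+) v i.+1 j (+) h i j.+1 (+) v i j = false) ->
  \big[addb/false]_(0 <= i < a) h i 0%N (+) \big[addb/false]_(0 <= i < a) h i b
  (+) \big[addb/false]_(0 <= j < b) v 0%N j (+) \big[addb/false]_(0 <= j < b) v a j = false.
Proof.
move=> h v H.
have col i : (i < a)%N -> h i 0%N (+) h i b =
    \big[addb/false]_(0 <= j < b) v i j (+) \big[addb/false]_(0 <= j < b) v i.+1 j.
  move=> ia; rewrite -(addb_tele (h i)) -big_split /=.
  apply: eq_big_nat => j /andP[_ jb]; have := H i j ia jb.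
  by case: (h i j); case: (h i j.+1); case: (v i j); case: (v i.+1 j).
rewrite -big_split /= (eq_big_nat _ _ (fun i (Hi : (0 <= i < a)%N) => col i (proj2 (andP Hi)))).
rewrite (addb_tele (fun i => \big[addb/false]_(0 <= j < b) v i j)).
by rewrite -addbA addbb.
Qed.

Lemma bichrome_triangle l1 l2 l3 : (l1 == l2) || (l2 == l3) || (l1 == l3) ->
  bichrome l1 l2 (+) bichrome l2 l3 = bichrome l1 l3.
Proof. by case: l1 => [[]|]; case: l2 => [[]|]; case: l3 => [[]|]. Qed.

Lemma bichromeC l l' : bichrome l l' = bichrome l' l.
Proof. by case: l => [[]|]; case: l' => [[]|]. Qed.

End Sperner.

Section Hex.
Variables (dg : int -> bool) (o : pred vertex) (x0 x1 y0 y1 c e : int).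

(* The boundary of the rectangle is cut into four arcs by the bottom point [c]
   and the top point [e]. *)
Lemma hex : x0 < c <= x1 -> x0 <= e <= x1 -> y0 <= y1 ->
  (forall x, x0 <= x < c -> o (x, y0)) ->
  (forall x, c <= x <= x1 -> ~~ o (x, y0)) ->
  (exists u v : vertex, [/\ u.2 = y0 /\ u.1 < c, v.1 = x1 \/ v.2 = y1 /\ e <= v.1 &
     conn (gadj dg) (fun z => rect x0 x1 y0 y1 z && o z) u v]) \/
  (exists u v : vertex, [/\ u.2 = y0 /\ c <= u.1, v.1 = x0 \/ v.2 = y1 /\ v.1 <= e &
     conn (gadj dg) (fun z => rect x0 x1 y0 y1 z && ~~ o z) u v]).
Proof.
move=> hc he hy oA oB; apply: contrapT => /not_orP[nA nB].
pose A z := `[< exists2 u : vertex, u.2 = y0 /\ u.1 < c &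
   conn (gadj dg) (fun z => rect x0 x1 y0 y1 z && o z) u z >].
pose B z := `[< exists2 u : vertex, u.2 = y0 /\ c <= u.1 &
   conn (gadj dg) (fun z => rect x0 x1 y0 y1 z && ~~ o z) u z >].
have Ao z : A z -> o z by move/asboolP => [u _ /conn_end /andP[]].
have Bo z : B z -> ~~ o z by move/asboolP => [u _ /conn_end /andP[]].
pose lab z := if A z then Some true else if B z then Some false else None.
have labE z z' : rect x0 x1 y0 y1 z -> rect x0 x1 y0 y1 z' -> gadj dg z z' ->
    o z = o z' -> lab z = lab z'.
  have aux u u' : rect x0 x1 y0 y1 u -> rect x0 x1 y0 y1 u' -> gadj dg u u' ->
      o u = o u' -> (A u -> A u') /\ (B u -> B u').
    move=> ru ru' uu' ouu'; split=> [Au|Bu].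
      have ou := Ao _ Au; have ou' := ou; rewrite ouu' in ou'.
      move/asboolP: Au => [t Ht tu]; apply/asboolP; exists t => //.
      by apply: conn_trans tu _; apply: conn1; rewrite ?ru ?ru' ?ou ?ou'.
    have ou := Bo _ Bu; have ou' := ou; rewrite ouu' in ou'.
    move/asboolP: Bu => [t Ht tu]; apply/asboolP; exists t => //.
    by apply: conn_trans tu _; apply: conn1; rewrite ?ru ?ru' ?ou ?ou'.
  move=> rz rz' zz' oz; have [A1 B1] := aux _ _ rz rz' zz' oz.
  have [A2 B2] := aux _ _ rz' rz ltac:(by rewrite gadj_sym) (esym oz).
  have EA : A z = A z' by apply/idP/idP.
  have EB : B z = B z' by apply/idP/idP.
  by rewrite /lab EA EB.
pose V (i j : nat) : vertex := (x0 + i%:Z, y0 + j%:Z).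
pose a := `|x1 - x0|%N; pose b := `|y1 - y0|%N.
have Va i j : (i <= a)%N -> (j <= b)%N -> rect x0 x1 y0 y1 (V i j).
  by move=> ia jb; rewrite /rect /V /=; lia.
have tri z1 z2 z3 : rect x0 x1 y0 y1 z1 -> rect x0 x1 y0 y1 z2 ->
    rect x0 x1 y0 y1 z3 -> gadj dg z1 z2 -> gadj dg z2 z3 -> gadj dg z1 z3 ->
    bichrome (lab z1) (lab z2) (+) bichrome (lab z2) (lab z3) = bichrome (lab z1) (lab z3).
  move=> r1 r2 r3 a12 a23 a13; apply: bichrome_triangle.
  have [E|N12] := eqVneq (o z1) (o z2); first by rewrite (labE _ _ r1 r2) // eqxx.
  have [E|N23] := eqVneq (o z2) (o z3); first by rewrite (labE _ _ r2 r3) // eqxx orbT.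
  rewrite (labE _ _ r1 r3) // ?eqxx ?orbT //.
  by move: N12 N23; case: (o z1); case: (o z2); case: (o z3).
have adjV i j i' j' : gadj dg (V i j) (V i' j') =
    [|| (i == i') && ((j' == j.+1) || (j == j'.+1)),
      (i' == i.+1) && ((j' == j) || (if dg (x0 + i%:Z) then j == j'.+1 else j' == j.+1))
    | (i == i'.+1) && ((j' == j) || (if dg (x0 + i'%:Z) then j' == j.+1 else j == j'.+1))].
  by rewrite /gadj /V /=; case: (dg (x0 + i%:Z)); case: (dg (x0 + i'%:Z)); lia.
have cell i j : (i < a)%N -> (j < b)%N ->
    bichrome (lab (V i j)) (lab (V i.+1 j)) (+) bichrome (lab (V i.+1 j)) (lab (V i.+1 j.+1))
    (+) bichrome (lab (V i j.+1)) (lab (V i.+1 j.+1)) (+) bichrome (lab (V i j)) (lab (V i j.+1))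
    = false.
  move=> ia jb.
  have r00 := Va i j ltac:(lia) ltac:(lia).
  have r10 := Va i.+1 j ltac:(lia) ltac:(lia).
  have r01 := Va i j.+1 ltac:(lia) ltac:(lia).
  have r11 := Va i.+1 j.+1 ltac:(lia) ltac:(lia).
  case E : (dg (x0 + i%:Z)).
    have := tri _ _ _ r00 r10 r01; have := tri _ _ _ r10 r11 r01.
    rewrite !adjV E !eqxx ?orbT /= ?andbT ?orbT => /(_ isT isT isT) T1 /(_ isT isT isT) <-.
    rewrite -T1 [bichrome (lab (V i.+1 j.+1)) _]bichromeC.
    by do 3!case: (bichrome _ _).
  have := tri _ _ _ r00 r10 r11; have := tri _ _ _ r00 r01 r11.
  rewrite !adjV E !eqxx ?orbT /= ?andbT ?orbT => /(_ isT isT isT) T1 /(_ isT isT isT).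
  by rewrite -T1; do 4!case: (bichrome _ _).
have labA z : A z -> lab z = Some true by rewrite /lab => ->.
have labB z : B z -> lab z = Some false.
  move=> Bz; rewrite /lab Bz; case: ifP => // /Ao oz.
  by have := Bo _ Bz; rewrite oz.
have labNB z : ~ B z -> lab z <> Some false.
  by rewrite /lab; case: (A z); case: (B z).
have labNA z : ~ A z -> lab z <> Some true.
  by rewrite /lab; case: (A z); case: (B z).
have noB z z' : ~ B z -> ~ B z' -> bichrome (lab z) (lab z') = false.
  move=> /labNB + /labNB.
  by case: (lab z) => [[]|] //; case: (lab z') => [[]|].
have noA z z' : ~ A z -> ~ A z' -> bichrome (lab z) (lab z') = false.
  move=> /labNA + /labNA.
  by case: (lab z) => [[]|] //; case: (lab z') => [[]|].
have nA' z : z.1 = x1 \/ z.2 = y1 /\ e <= z.1 -> ~ A z.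
  by move=> Hz /asboolP[u Hu uz]; apply: nA; exists u, z.
have nB' z : z.1 = x0 \/ z.2 = y1 /\ z.1 <= e -> ~ B z.
  by move=> Hz /asboolP[u Hu uz]; apply: nB; exists u, z.
have := sperner cell.
rewrite (eq_big_nat _ _ (F2 := fun i => (i < `|c - x0|)%N (+) (i.+1 < `|c - x0|)%N)); last first.
  move=> i /andP[_ ia].
  have lA k : (k < `|c - x0|)%N -> lab (V k 0%N) = Some true.
    move=> kc; apply: labA; apply/asboolP; exists (V k 0%N); first by rewrite /V /=; lia.
    apply: conn_refl; rewrite Va /=; [|lia|lia]; rewrite /V addr0; apply: oA; lia.
  have lB k : (k <= a)%N -> (`|c - x0| <= k)%N -> lab (V k 0%N) = Some false.
    move=> ka kc; apply: labB; apply/asboolP; exists (V k 0%N); first by rewrite /V /=; lia.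
    apply: conn_refl; rewrite Va /=; [|lia|lia]; rewrite /V addr0; apply: oB; lia.
  have [i1|i1] := ltnP i.+1 `|c - x0|.
    by rewrite !lA // ?i1 ?(ltnW i1) //; lia.
  have [i0|i0] := ltnP i `|c - x0|; first by rewrite lA // lB.
  by rewrite !lB //; lia.
rewrite (addb_tele (fun i => (i < `|c - x0|)%N)).
rewrite (_ : (0 < _)%N = true); last lia.
rewrite (_ : (a < _)%N = false); last lia.
rewrite !big1_seq //= => i; rewrite mem_index_iota /= => ia.
- by apply: noA; apply: nA'; left; rewrite /V /=; lia.
- by apply: noB; apply: nB'; left; rewrite /V /=; lia.
have [ie|ie] := ltP (x0 + i%:Z) e.
  by apply: noB; apply: nB'; right; rewrite /V /=; lia.
by apply: noA; apply: nA'; right; rewrite /V /=; lia.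
Qed.

End Hex.

Section Crossing.
Variable dg : int -> bool.
Implicit Types (u v w z : vertex) (s : seq vertex).

Fixpoint parity (r : rel vertex) u s : bool :=
  if s is u' :: s' then r u u' (+) parity r u' s' else false.

(* Whether the edge from [u] to [u'] meets the downward ray issued from a point
   slightly to the right of [v]. *)
Definition under v u u' : bool :=
  [|| [&& u.1 == v.1, u'.1 == v.1 + 1 & u.2 < v.2]
    | [&& u'.1 == v.1, u.1 == v.1 + 1 & u'.2 < v.2]].

Lemma parity_telescope (r : rel vertex) (F : pred vertex) u s :
  {in u :: s &, forall x y, gadj dg x y -> r x y = F x (+) F y} ->
  path (gadj dg) u s -> parity r u s = F u (+) F (last u s).
Proof.
elim: s u => [|a s IH] u H /=; first by rewrite addbb.
case/andP=> ua ps; rewrite H ?mem_head ?in_cons ?eqxx ?orbT // IH //; last first.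
  by move=> x y xs ys; apply: H; rewrite in_cons ?xs ?ys orbT.
by rewrite -addbA (addbA (F a)) addbb.
Qed.

Lemma parityD (r r' : rel vertex) u s :
  parity (fun x y => r x y (+) r' x y) u s = parity r u s (+) parity r' u s.
Proof.
elim: s u => //= a s IH u; rewrite IH.
by case: (r _ _); case: (r' _ _); case: (parity _ _ _); case: (parity _ _ _).
Qed.

Lemma eq_parity (r r' : rel vertex) u s :
  {in u :: s &, forall x y, r x y = r' x y} -> parity r u s = parity r' u s.
Proof.
elim: s u => //= a s IH u H; rewrite H ?mem_head ?in_cons ?eqxx ?orbT //; congr addb.
by apply: IH => x y xs ys; apply: H; rewrite in_cons ?xs ?ys orbT.
Qed.

Lemma under_up v w u u' : w.1 = v.1 -> w.2 = v.2 + 1 -> u != v -> u' != v ->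
  under v u u' = under w u u'.
Proof.
case: v w u u' => [a b] [a' b'] [x y] [x' y'] /= -> ->.
rewrite !xpair_eqE /under /=; lia.
Qed.

Lemma under_right v w u u' : w.1 = v.1 + 1 -> gadj dg v w -> gadj dg u u' ->
  u != v -> u' != v -> u != w -> u' != w ->
  under v u u' (+) under w u u' =
    ((u.1 == w.1) && (u.2 < w.2)) (+) ((u'.1 == w.1) && (u'.2 < w.2)).
Proof.
case: v w u u' => [a b] [a' b'] [x y] [x' y'] /= ->.
rewrite !xpair_eqE /gadj /under /=.
have [->|xa] := eqVneq x a; last first.
  have [->|x'a] := eqVneq x' a; last lia.
  case: (dg a); case: (dg x); lia.
case: (dg a); case: (dg x'); lia.
Qed.

(* The parity of the number of times the downward ray from [v] meets the curve
   obtained from the walk [u :: s] by adding a horizontal half-line to the left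
   of its first vertex and one to the right of its last vertex. *)
Definition side u s v : bool :=
  parity (under v) u s (+) (((last u s).1 <= v.1) && ((last u s).2 < v.2))
  (+) ((v.1 < u.1) && (u.2 < v.2)).

Definition on_curve u s v : bool :=
  [|| v \in u :: s, (v.2 == (last u s).2) && ((last u s).1 <= v.1)
    | (v.2 == u.2) && (v.1 <= u.1)].

Lemma side_adj u s v w : path (gadj dg) u s -> gadj dg v w ->
  ~~ on_curve u s v -> ~~ on_curve u s w -> side u s v = side u s w.
Proof.
move=> ps; wlog vw : v w / (w.1 = v.1 /\ w.2 = v.2 + 1) \/ w.1 = v.1 + 1.
  move=> H vw Hv Hw.
  have [|] : ((w.1 = v.1 /\ w.2 = v.2 + 1) \/ w.1 = v.1 + 1) \/
    ((v.1 = w.1 /\ v.2 = w.2 + 1) \/ v.1 = w.1 + 1) by move: vw; rewrite /gadj; lia.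
    by move=> C; apply: H.
  by move=> C; apply/esym; apply: H => //; rewrite gadj_sym.
move=> avw; case/norP => vs /norP[v1 v2]; case/norP => ws /norP[w1 w2].
have neq x y : x \in u :: s -> y \notin u :: s -> x != y.
  by move=> xs; apply: contra => /eqP <-.
rewrite /side; case: vw => [[E1 E2]|E1].
  rewrite (@eq_parity (under v) (under w)); last first.
    by move=> x y xs ys; apply: under_up => //; apply: neq.
  rewrite E1; congr (_ (+) _ (+) _); first by move: v1 w1; lia.
  by move: v2 w2; lia.
have : parity (fun x y => under v x y (+) under w x y) u s =
    ((u.1 == w.1) && (u.2 < w.2)) (+)
    (((last u s).1 == w.1) && ((last u s).2 < w.2)).
  apply: (@parity_telescope _ (fun x => (x.1 == w.1) && (x.2 < w.2))) => // x y xs ys xy.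
  by apply: under_right => //; apply: neq.
rewrite parityD => /(congr1 (addb (parity (under w) u s))).
rewrite addbC -addbA addbb addbF => ->; rewrite -!addbA; congr (_ (+) _).
have us : u != w by apply: neq; rewrite ?mem_head.
have ls : last u s != w by apply: neq; rewrite ?mem_last.
have uv : u != v by apply: neq; rewrite ?mem_head.
have lv : last u s != v by apply: neq; rewrite ?mem_last.
move: us ls uv lv v1 v2 w1 w2 avw E1; case: (last u s) => [lx ly].
case: u {ps vs ws neq} => [a b]; case: v => [vx vy]; case: w => [wx wy] /=.
rewrite /gadj /= !xpair_eqE => us ls uv lv v1 v2 w1 w2 avw E1.
have D : wy = vy \/ wy = vy + 1 \/ vy = wy + 1 by move: avw; case: (dg vx); case: (dg wx); lia.
have L1 : ((lx == wx) && (ly < wy)) (+) ((lx <= vx) && (ly < vy)) = (lx <= wx) && (ly < wy).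
  by clear us uv ls lv v2 w2 avw; lia.
have L2 : ((a == wx) && (b < wy)) (+) ((vx < a) && (b < vy)) = (wx < a) && (b < wy).
  by clear us uv ls lv v1 w1 avw L1; lia.
by rewrite -L1 -L2; do 4!case: (_ && _).
Qed.

Lemma side_conn u s (S : pred vertex) v w : path (gadj dg) u s ->
  (forall z, S z -> ~~ on_curve u s z) -> conn (gadj dg) S v w ->
  side u s v = side u s w.
Proof.
move=> ps HS [t [pt <- St]]; elim: t v pt St => //= a t IH v /andP[va pt].
move=> /and3P[Sv Sa St]; rewrite -IH //= ?Sa //.
by apply: side_adj => //; apply: HS.
Qed.

Lemma parity_under_low u s v : {in u :: s, forall x : vertex, v.2 <= x.2} ->
  parity (under v) u s = false.
Proof.
move=> H; rewrite (@eq_parity _ (fun _ _ => false)).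
  by elim: s u {H} => //= a s IH u.
move=> x y /H xs /H ys; rewrite /under.
by move: v x y xs ys {H} => [a b] [x x'] [y y'] /=; lia.
Qed.

Lemma parity_under_far u s v : {in u :: s, forall x : vertex, v.1 + 1 <= x.1} \/
    {in u :: s, forall x : vertex, x.1 <= v.1} ->
  parity (under v) u s = false.
Proof.
move=> H; rewrite (@eq_parity _ (fun _ _ => false)).
  by elim: s u {H} => //= a s IH u.
by case: H => H x y /H xs /H ys; rewrite /under;
  move: v x y xs ys {H} => [a b] [x x'] [y y'] /=; lia.
Qed.

Lemma parity_under_high u s v : path (gadj dg) u s ->
  v \notin u :: s -> {in u :: s, forall x : vertex, x.2 <= v.2} ->
  parity (under v) u s = (u.1 <= v.1) (+) ((last u s).1 <= v.1).
Proof.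
move=> ps vs H; apply: (@parity_telescope _ (fun x => x.1 <= v.1)) => // x y xs ys xy.
have Hx := H x xs; have Hy := H y ys.
have xv : x != v by apply: contra vs => /eqP <-.
have yv : y != v by apply: contra vs => /eqP <-.
move: x y v xv yv Hx Hy xy {H vs xs ys} => [x x'] [y y'] [a b] /=.
rewrite !xpair_eqE /gadj /under /= => xv yv Hx Hy xy.
have D : y = x \/ y = x + 1 \/ x = y + 1 by lia.
clear xy; lia.
Qed.

End Crossing.

Lemma conn_ind_end (T : eqType) (e : rel T) (S Q : pred T) u v :
  (S u -> Q u) -> (forall x y, Q x -> S x -> S y -> e x y -> Q y) ->
  conn e S u v -> Q v.
Proof.
move=> Qu step [s [ps <- /= /andP[Su Ss]]]; move/(_ Su): Qu.
elim: s u ps Su Ss => //= a s IH u /andP[ua ps] Su /andP[Sa Ss] Qu.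
by apply: IH => //; apply: step ua.
Qed.

Lemma conn_inv (T : eqType) (e : rel T) (S Q : pred T) u v :
  (S u -> Q u) -> (forall x y, Q x -> S x -> S y -> e x y -> Q y) ->
  conn e S u v -> conn e (fun z => S z && Q z) u v.
Proof.
move=> Qu step [s [ps sv Ss]]; exists s; split=> //.
have {Qu} : Q u by case/andP: Ss => /Qu.
elim: s u ps Ss {sv} => /= [|a s IH] u; first by rewrite !andbT => _ -> ->.
by move=> /andP[ua ps] /and3P[Su Sa Ss] Qu; rewrite Su Qu IH //= ?Sa //; apply: step ua.
Qed.

Lemma conn_map (T T' : eqType) (e : rel T) (e' : rel T') (f : T -> T') (S : pred T)
    (S' : pred T') u v :
  (forall x y, S x -> S y -> e x y -> e' (f x) (f y)) -> (forall x, S x -> S' (f x)) ->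
  conn e S u v -> conn e' S' (f u) (f v).
Proof.
move=> fe fS [s [ps <- Ss]]; exists (map f s); split; last 2 first.
- by rewrite last_map.
- by rewrite -map_cons all_map; apply: sub_all Ss.
elim: s u ps Ss => //= a s IH u /andP[ua ps] /and3P[Su Sa Ss].
by rewrite fe //= IH //= Sa.
Qed.

Lemma vertex_eq (u v : vertex) : u.1 = v.1 -> u.2 = v.2 -> u = v.
Proof. by case: u v => [a b] [c d] /= -> ->. Qed.

(* The instance of [conn_split] at a carrier that [lia] recognizes. *)
Lemma conn_splitv (e : rel vertex) (S Q : pred vertex) (u v : vertex) :
  conn e S u v -> Q u -> ~~ Q v ->
  exists x y : vertex, [/\ conn e S u x, Q x, e x y & conn e (fun z => S z && ~~ Q z) y v].
Proof. exact: conn_split. Qed.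

Section Rectangles.
Variable dg : int -> bool.
Implicit Types (o S : pred vertex) (u v z : vertex).

Lemma gadj_step u v : gadj dg u v -> `|u.1 - v.1| <= 1 /\ `|u.2 - v.2| <= 1.
Proof. by rewrite /gadj; case: (dg u.1); case: (dg v.1); lia. Qed.

Lemma hex_lr o (x0 x1 y0 y1 : int) : x0 <= x1 -> y0 <= y1 ->
  (exists u v : vertex, [/\ u.1 = x0, v.1 = x1 &
     conn (gadj dg) (fun z => rect x0 x1 y0 y1 z && o z) u v]) \/
  (exists u v : vertex, [/\ u.2 = y0, v.2 = y1 &
     conn (gadj dg) (fun z => rect x0 x1 y0 y1 z && ~~ o z) u v]).
Proof.
move=> hx hy.
pose o' z := (z.1 < x0) || (y0 <= z.2) && o z.
have := @hex dg o' (x0 - 1) x1 (y0 - 1) y1 x0 x1.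
case; [lia | lia | lia | by move=> x Hx; rewrite /o' /=; case: (o _); lia
  | by move=> x Hx; rewrite /o' /=; case: (o _); lia | |].
  case=> u [v [[u2 u1] Hv uv]]; left.
  have := conn_end uv; rewrite {1}/rect => /andP[rv _].
  have {Hv} v1 : v.1 = x1 by lia.
  have [||x [y [_ Qx xy yv]]] := @conn_splitv _ _ (fun z => z.1 < x0) _ _ uv;
    [by [] || rewrite /=; lia | rewrite /= -?leNgt; lia |].
  have /andP[/andP[+ _] +] := conn_start yv; rewrite /rect => Hy Hy'.
  have := gadj_step xy => Hxy; exists y, v; split=> //; first lia.
  by apply: conn_sub yv => z; rewrite /rect /o'; case: (o z); lia.
case=> u [v [[u2 u1] Hv uv]]; right.
have /andP[+ +] := conn_end uv; rewrite {1}/rect {1}/o' => rv ov.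
have {Hv ov} v1 : v.2 = y1 by case: (o v) ov; lia.
have [||x [y [_ Qx xy yv]]] := @conn_splitv _ _ (fun z => z.2 < y0) _ _ uv;
  [by [] || rewrite /=; lia | rewrite /= -?leNgt; lia |].
have /andP[/andP[+ _] +] := conn_start yv; rewrite /rect => Hy Hy'.
have := gadj_step xy => Hxy; exists y, v; split=> //; first lia.
by apply: conn_sub yv => z; rewrite /rect /o'; case: (o z); lia.
Qed.

Lemma lr_meets_bt S S' (x0 x1 y0 y1 : int) u v (a b : vertex) :
  u.1 = x0 -> v.1 = x1 -> a.2 = y0 -> b.2 = y1 ->
  conn (gadj dg) (fun z => rect x0 x1 y0 y1 z && S z) u v ->
  conn (gadj dg) (fun z => rect x0 x1 y0 y1 z && S' z) a b ->
  exists2 z, S z & S' z.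
Proof.
move=> u1 v1 a2 b2 [s [ps sv Ss]] ab; apply: contrapT => nz.
have dis z : z \in u :: s -> S' z -> False.
  by move=> /(allP Ss)/andP[_ Sz] S'z; apply: nz; exists z.
have rs z : z \in u :: s -> rect x0 x1 y0 y1 z by move=> /(allP Ss)/andP[].
have offc z : rect x0 x1 y0 y1 z && S' z -> ~~ on_curve u s z.
  move=> /andP[rz S'z]; apply/negP; rewrite /on_curve sv => /or3P[zs|zv|zu].
  - exact: dis zs S'z.
  - apply: dis S'z; rewrite (_ : z = v) -?sv ?mem_last //.
    by apply: vertex_eq; move: rz zv; rewrite /rect ?sv; lia.
  - apply: dis S'z; rewrite (_ : z = u) ?mem_head //.
    by apply: vertex_eq; move: rz zu; rewrite /rect; lia.
have := side_conn ps offc ab.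
have /andP[ra _] := conn_start ab; have /andP[rb _] := conn_end ab.
have bs : b \notin u :: s by have := offc _ (conn_end ab); rewrite /on_curve => /norP[].
have vb : v != b by apply: contra bs => /eqP <-; rewrite -sv mem_last.
have us := rs u (mem_head _ _); have vs := rs v; rewrite -{1}sv mem_last in vs.
have {}vs := vs isT.
rewrite /side parity_under_low; last first.
  by move=> x /rs; rewrite /rect; lia.
rewrite (parity_under_high ps) //; last first.
  by move=> x /rs; rewrite /rect; lia.
rewrite sv; move: ra rb us vs vb; rewrite /rect; case: (v) v1 => [v1 v2].
by case: (b) b2 => [b1 b2]; rewrite xpair_eqE /=; lia.
Qed.

Definition rectl (x0 x1 y0 y1 : int) : seq vertex :=
  [seq (x0 + i%:Z, y0 + j%:Z) | i <- iota 0 (absz (x1 + 1 - x0)%R),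
                                j <- iota 0 (absz (y1 + 1 - y0)%R)].

Lemma mem_rectl (x0 x1 y0 y1 : int) z : x0 <= x1 -> y0 <= y1 ->
  (z \in rectl x0 x1 y0 y1) = rect x0 x1 y0 y1 z.
Proof.
move=> hx hy; apply/allpairsP/idP => [[[i j] /= [+ + ->]]|rz].
  by rewrite !mem_iota /rect /=; lia.
exists (`|z.1 - x0|%N, `|z.2 - y0|%N); move: rz; rewrite /rect !mem_iota /=.
by case: z => a b /= rz; split; [lia | lia | congr pair; lia].
Qed.

Lemma uniq_rectl (x0 x1 y0 y1 : int) : uniq (rectl x0 x1 y0 y1).
Proof.
apply: allpairs_uniq; rewrite ?iota_uniq // => [[i j]] [i' j'] /= _ _ [].
by move=> *; congr pair; lia.
Qed.

End Rectangles.

Section Events.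
Variables (T : eqType) (R : realFieldType).
Implicit Types (w : T -> bool) (E : (T -> bool) -> Prop) (s D : seq T).

Definition ind E w : R := (`[< E w >])%:R.

Lemma ind01 E w : 0 <= ind E w <= 1.
Proof. by rewrite /ind; case: `[< _ >]; rewrite ?lexx ler01. Qed.

Lemma ind_ge0 E w : 0 <= ind E w.
Proof. by case/andP: (ind01 E w). Qed.

Lemma ind_le1 E w : ind E w <= 1.
Proof. by case/andP: (ind01 E w). Qed.

Lemma ind_le E E' w w' : (E w -> E' w') -> ind E w <= ind E' w'.
Proof.
by move=> H; rewrite /ind; case: asboolP => [/H/asboolP ->|_] //; rewrite ler0n.
Qed.

Lemma ind_eq E E' w w' : (E w <-> E' w') -> ind E w = ind E' w'.
Proof. by case=> H H'; apply/le_anti; rewrite !ind_le. Qed.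

Lemma ind_incr E : (forall w w', (forall v, w v -> w' v) -> E w -> E w') -> incr (ind E).
Proof. by move=> H w w' ww; apply: ind_le; apply: H. Qed.

Lemma ind_supported E D :
  (forall w w', {in D, w =1 w'} -> E w -> E w') -> supported D (ind E).
Proof.
move=> H w w' ww; apply: ind_eq; split; apply: H => // v vD.
by rewrite ww.
Qed.

Lemma indI E E' w : ind E w * ind E' w = ind (fun w => E w /\ E' w) w.
Proof.
rewrite /ind; case: asboolP => a; case: asboolP => b; case: asboolP => c;
  rewrite ?mulr1 ?mulr0 //; tauto.
Qed.

Lemma avg_le_on (p : R) s (f g : (T -> bool) -> R) w : 0 <= p <= 1 ->
  (forall w', (forall v, v \notin s -> w' v = w v) -> f w' <= g w') ->
  avg p s f w <= avg p s g w.
Proof.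
case/andP=> p0 p1; elim: s w => [|v s IH] w H /=; first exact: H.
rewrite /avg1; apply: lerD; apply: ler_wpM2l; rewrite ?subr_ge0 //; apply: IH => w' ww;
  apply: H => u; rewrite in_cons negb_or => /andP[uv us];
  by rewrite ww // /upd (negbTE uv).
Qed.

End Events.

(** * Crossings of long rectangles *)

(* With these diagonals, alternating from one column of cells to the next, the
   grid is the triangular lattice seen with one family of its lines vertical,
   and every vertical line [x = L] is an axis of symmetry. *)
Definition zigzag (i : int) : bool := (i %% 2)%Z == 0.

Definition refl (L : int) (v : vertex) : vertex := (L + L - v.1, v.2).

Lemma reflK L : involutive (refl L).
Proof. by move=> v; apply: vertex_eq => //=; lia. Qed.

Lemma gadj_refl L u v : gadj zigzag (refl L u) (refl L v) = gadj zigzag u v.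
Proof.
case: u v => [a b] [c d]; rewrite /gadj /refl /zigzag /=.
by case: ifP; case: ifP; case: ifP; case: ifP; lia.
Qed.

Definition lr_cross dg x0 x1 y0 y1 (w : vertex -> bool) : Prop :=
  exists u v : vertex, [/\ u.1 = x0, v.1 = x1 &
    conn (gadj dg) (fun z => rect x0 x1 y0 y1 z && w z) u v].

Definition left_to_right_or_top (L h : int) (w : vertex -> bool) : Prop :=
  exists u v : vertex, [/\ u.1 = 0, v.1 = L + L \/ v.2 = h /\ L <= v.1 &
    conn (gadj zigzag) (fun z => rect 0 (L + L) 0 h z && w z) u v].

Section Doubling.
Variables (L h : int).
Hypotheses (L1 : 1 <= L) (h0 : 0 <= h).
Implicit Types (u v z : vertex) (w : vertex -> bool).

Let rL := rect 0 L 0 h.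
Let r2 := rect 0 (L + L) 0 h.
Let rho := refl L.
Let adj := gadj zigzag.

Let adj_sym : symmetric adj. Proof. exact: gadj_sym. Qed.

Lemma parity_rcons (r : rel vertex) u s z :
  parity r u (rcons s z) = parity r u s (+) r (last u s) z.
Proof.
elim: s u => [|a s IH] u /=; first by rewrite addbF.
by rewrite IH addbA.
Qed.

Lemma glue_crossings w : left_to_right_or_top L h w ->
  left_to_right_or_top L h (w \o rho) -> lr_cross zigzag 0 (L + L) 0 h w.
Proof.
move=> [u [v [u1 Hv uv]]] [u' [v' [u1' Hv' uv']]].
have {}uv' : conn adj (fun z => r2 z && w z) (rho u') (rho v').
  apply: conn_map uv' => [x y _ _|x]; first by rewrite /adj /rho gadj_refl.
  by case: x => a b; rewrite /r2 /rho /rect /refl /=; case: (w _); lia.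
have {u1'} : (rho u').1 = L + L by rewrite /rho /= u1'; lia.
have {Hv'} : (rho v').1 = 0 \/ (rho v').2 = h /\ (rho v').1 <= L.
  by rewrite /rho /=; lia.
move: uv'; move: (rho u') (rho v') => {u' v'} a b ab Hb a1.
case: Hv => [v1|[v2 v1]]; first by exists u, v.
case: Hb => [b1|[b2 b1]].
  by exists b, a; split=> //; apply: conn_sym.
apply: contrapT => nlr.
case: (uv) => s [ps sv Ss].
have dis z : z \in u :: s -> conn adj (fun z => r2 z && w z) a z -> False.
  move=> zs az; apply: nlr; exists u, a; split=> //.
  apply: conn_trans (conn_sym adj_sym az).
  case/splitPl: zs ps Ss => s1 s2 <-; rewrite cat_path -cat_cons all_cat.
  by case/andP=> p1 _ /andP[S1 _]; exists s1.
have rs z : z \in u :: s -> r2 z by move=> /(allP Ss)/andP[].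
pose t := rcons s (v.1, h + 1).
have pt : path adj u t.
  by rewrite rcons_path ps sv /adj /gadj /= v2 !eqxx /= ?orbT.
have lt : last u t = (v.1, h + 1) by rewrite last_rcons.
have {}ab := conn_inv (Q := fun z => `[< conn adj (fun z => r2 z && w z) a z >])
  (fun Sa => asboolT (conn_refl _ Sa))
  (fun x y ax Sx Sy xy => asboolT (conn_trans (asboolW ax) (conn1 Sx Sy xy))) ab.
have off z : (r2 z && w z) && `[< conn adj (fun z => r2 z && w z) a z >] ->
    ~~ on_curve u t z.
  move=> /andP[/andP[rz wz] /asboolP az]; apply/negP.
  rewrite /on_curve lt -rcons_cons mem_rcons in_cons => /or3P[/orP[|zs]|zv|zu].
  - by move=> /eqP zE; move: rz; rewrite zE /r2 /rect /=; lia.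
  - exact: dis zs az.
  - by move: rz zv; rewrite /r2 /rect /=; lia.
  - apply: dis az; rewrite (_ : z = u) ?mem_head //.
    by apply: vertex_eq; move: rz zu; rewrite /r2 /rect; lia.
have := side_conn pt off ab.
have /andP[/andP[ra _] _] := conn_start ab; have /andP[/andP[rb _] /asboolP cb] := conn_end ab.
have ru := rs u (mem_head _ _).
have rv : r2 v by apply: rs; rewrite -sv mem_last.
have nbv : v <> b by move=> E; apply: (dis b) => //; rewrite -E -sv mem_last.
rewrite /side lt !parity_rcons sv /=.
rewrite (parity_under_far (v := a)); last first.
  by right=> x /rs; rewrite /r2 /rect; lia.
rewrite (parity_under_high ps) ?sv; first last.
- by move=> x /rs; rewrite /r2 /rect; lia.
- by apply/negP => /dis; apply.
have b1v : b.1 < v.1.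
  rewrite lt_neqAle; apply/andP; split; last lia.
  by apply/eqP => E; apply: nbv; apply: vertex_eq => //; lia.
have nu z : under z v (v.1, h + 1) = false by rewrite /under /=; lia.
rewrite !nu /=; move: ra rb ru rv; rewrite /r2 /rect => ra rb ru rv.
have -> : h + 1 < a.2 = false by lia.
have -> : h + 1 < b.2 = false by lia.
have -> : a.1 < u.1 = false by lia.
have -> : b.1 < u.1 = false by lia.
have -> : u.1 <= b.1 by lia.
have -> : v.1 <= b.1 = false by lia.
by rewrite !andbF.
Qed.

End Doubling.

Section Exploration.
Variables (L h : int).
Hypotheses (L1 : 1 <= L) (h0 : 0 <= h).
Implicit Types (u v z : vertex) (w : vertex -> bool).

Let rL := rect 0 L 0 h.
Let r2 := rect 0 (L + L) 0 h.
Let rho := refl L.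
Let adj := gadj zigzag.

Let adj_sym : symmetric adj. Proof. exact: gadj_sym. Qed.

Definition bottom_cluster w v : bool :=
  `[< exists2 a : vertex, a.2 = 0 & conn adj (fun z => rL z && ~~ w z) a v >].

Definition explored w v : bool :=
  rL v && ((v.2 == 0) || `[< exists2 c, bottom_cluster w c & adj c v >]
           || bottom_cluster w v).

Lemma bottom_clusterP w v : bottom_cluster w v -> rL v && ~~ w v.
Proof. by move/asboolP => [a _ /conn_end]. Qed.

Lemma bottom_cluster_bottom w v : rL v -> ~~ w v -> v.2 = 0 -> bottom_cluster w v.
Proof. by move=> rv wv v2; apply/asboolP; exists v => //; apply: conn_refl; rewrite rv. Qed.

Lemma bottom_cluster_step w u v : bottom_cluster w u -> rL v -> ~~ w v -> adj u v ->
  bottom_cluster w v.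
Proof.
move=> Cu rv wv uv; have /andP[ru wu] := bottom_clusterP Cu.
move/asboolP: Cu => [a a2 au]; apply/asboolP; exists a => //.
by apply: conn_trans au _; apply: conn1; rewrite ?ru ?rv.
Qed.

Lemma cluster_explored w v : bottom_cluster w v -> explored w v.
Proof. by move=> Cv; have /andP[rv _] := bottom_clusterP Cv; rewrite /explored rv Cv orbT. Qed.

Lemma explored_rL w v : explored w v -> rL v. Proof. by case/andP. Qed.

Lemma explored_adj w c v : bottom_cluster w c -> rL v -> adj c v -> explored w v.
Proof.
move=> Cc rv cv; rewrite /explored rv /=; apply/orP; left; apply/orP; right.
by apply/asboolP; exists c.
Qed.

Lemma explored_bottom w v : rL v -> v.2 = 0 -> explored w v.
Proof. by move=> rv v2; rewrite /explored rv v2. Qed.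

Lemma explored_open w v : explored w v -> ~~ bottom_cluster w v -> w v.
Proof.
case/andP=> rv /orP[/orP[/eqP v2|/asboolP[c Cc cv]]|->] // nC.
  by apply: contraNT nC => wv; apply: bottom_cluster_bottom.
by apply: contraNT nC => wv; apply: bottom_cluster_step cv.
Qed.

Lemma bottom_cluster_conn w v : bottom_cluster w v ->
  exists2 a : vertex, a.2 = 0 & conn adj (bottom_cluster w) a v.
Proof.
move/asboolP=> [a a2 av]; exists a => //.
suff : conn adj (fun z => (rL z && ~~ w z) && bottom_cluster w z) a v.
  by apply: conn_sub => z /andP[].
apply: conn_inv av => [/andP[ra wa]|x y Cx _ /andP[ry wy] xy].
  exact: bottom_cluster_bottom.
exact: bottom_cluster_step xy.
Qed.

Lemma explored_self w w' : {in explored w, w =1 w'} -> explored w' =1 explored w.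
Proof.
move=> ww.
have sub1 v : bottom_cluster w v -> bottom_cluster w' v.
  move=> /bottom_cluster_conn[a a2 av]; apply/asboolP; exists a => //.
  apply: conn_sub av => z Cz; have /andP[-> wz] := bottom_clusterP Cz.
  by rewrite -ww // unfold_in; apply: cluster_explored.
have sub2 v : bottom_cluster w' v -> bottom_cluster w v.
  move=> /bottom_cluster_conn[a a2]; apply: conn_ind_end.
    move=> /bottom_clusterP/andP[ra wa]; apply: bottom_cluster_bottom => //.
    by rewrite ww // unfold_in; apply: explored_bottom.
  move=> x y Cx _ /bottom_clusterP/andP[ry wy] xy.
  apply: (bottom_cluster_step Cx ry _ xy).
  by rewrite ww // unfold_in; apply: explored_adj xy.
have EC : bottom_cluster w' = bottom_cluster w.
  by apply: funext => v; apply/idP/idP; [exact: sub2 | exact: sub1].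
by move=> v; rewrite /explored EC.
Qed.

Lemma lowest_crossing w : lr_cross zigzag 0 L 0 h w ->
  exists u v : vertex, [/\ u.1 = 0, v.1 = L &
    conn adj (fun z => explored w z && ~~ bottom_cluster w z) u v].
Proof.
move=> [u [v [u1 v1 uv]]].
have [| |[a [b [a1 b1 ab]]]|[a [b [a2 b2 ab]]]] := @hex_lr zigzag
  (fun z => explored w z && ~~ bottom_cluster w z) 0 L 0 h; [lia | lia | |].
  by exists a, b; split=> //; apply: conn_sub ab => z /andP[].
have step : conn adj (bottom_cluster w) a b.
  suff : conn adj (fun z => (rL z && ~~ (explored w z && ~~ bottom_cluster w z))
      && bottom_cluster w z) a b by apply: conn_sub => z /andP[].
  apply: conn_inv ab => [/andP[ra]|x y Cx _ /andP[ry + ] xy].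
    by rewrite explored_bottom //= negbK.
  by rewrite (explored_adj Cx ry xy) /= negbK.
have [|z] := lr_meets_bt u1 v1 a2 b2 uv (S' := bottom_cluster w).
  by apply: conn_sub step => z Cz; have /andP[rz _] := bottom_clusterP Cz; rewrite Cz andbT.
by move=> wz /bottom_clusterP/andP[_]; rewrite wz.
Qed.

Definition fresh w z : bool := [&& r2 z, ~~ explored w z & ~~ explored w (rho z)].

(* The sites not explored in [w] may have been resampled in [w'].  A connection
   that starts in the explored set and avoids the lowest crossing would end
   below the reflected crossing on the right side; together with its own
   reflection it would then separate the lowest crossing from the bottom side,
   although the exploration joins them. *)
Lemma explored_to_left w w' : lr_cross zigzag 0 L 0 h w ->
  (forall z, explored w z -> w' z = w z) ->
  (exists u v : vertex, [/\ explored w u, v.1 = L + L \/ v.2 = h /\ L <= v.1 &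
     conn adj (fun z => explored w z || (fresh w z && w' z)) u v]) ->
  left_to_right_or_top L h w'.
Proof.
move=> Hw ww' [u [v [Ku Hv uv]]].
set K := explored w in Ku uv ww' *; set C := bottom_cluster w.
have [u0 [v0 [u01 v01 uv0]]] := lowest_crossing Hw.
have KrL z : K z -> 0 <= z.1 <= L /\ 0 <= z.2 <= h.
  by move/explored_rL; rewrite /rL /rect => /andP[].
have Kopen z : K z -> ~~ C z -> w' z.
  by move=> Kz nCz; rewrite ww' //; apply: explored_open.
have CK z : C z -> K z by exact: cluster_explored.
have rho_axis z : K z -> K (rho z) -> rho z = z.
  move=> /KrL + /KrL; rewrite /rho /= => Hz Hr; apply: vertex_eq => //=; move: Hz Hr; clear; lia.
have r2v z : r2 z = (0 <= z.1 <= L + L) && (0 <= z.2 <= h) by [].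
have [k [Kk nCk kv]] : exists k, [/\ K k, ~~ C k &
    conn adj (fun z => (z == k) || (fresh w z && w' z)) k v].
  case: (boolP (K v)) => Kv.
    exists v; split=> //; last by apply: conn_refl; rewrite eqxx.
    have [v1 v2] : v.1 = L /\ v.2 = h by have := KrL _ Kv; lia.
    apply/negP => /bottom_cluster_conn[a a2 av].
    have [| |z] := @lr_meets_bt zigzag (fun z => K z && ~~ C z) C 0 L 0 h u0 v0 a v
      u01 v01 a2 v2.
    - apply: conn_sub uv0 => z Hz; rewrite /K /C Hz andbT.
      by case/andP: Hz => /explored_rL.
    - apply: conn_sub av => z Cz; rewrite /C Cz andbT.
      exact: explored_rL (CK _ Cz).
    - by move=> /andP[_ /negP nC] Cz; apply: nC.
  have [x [y [ux Kx xy yv]]] := conn_splitv uv Ku Kv.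
  have Fy : fresh w y && w' y.
    by have /andP[/orP[Ky|//] /negP] := conn_start yv.
  exists x; split=> //; last first.
    apply: (@conn_trans _ _ _ _ y).
      by apply: conn1; rewrite ?eqxx ?Fy ?orbT.
    apply: conn_sub yv => z /andP[/orP[->//|->]]; by rewrite orbT.
  apply/negP => Cx; have Hx := KrL _ (CK _ Cx).
  case/andP: Fy => /and3P[ry nKy nKry] _.
  have Hxy := gadj_step xy.
  have [yL|yL] := lerP y.1 L.
    move/negP: nKy; apply; apply: explored_adj Cx _ xy.
    by rewrite /rL /rect; move: ry; rewrite r2v; lia.
  have xL : x.1 = L by lia.
  have rx : rho x = x by apply: vertex_eq => //=; lia.
  move/negP: nKry; apply; apply: explored_adj Cx _ _; last by rewrite -rx /adj gadj_refl.
  by rewrite /rL /rect /=; move: ry; rewrite r2v; lia.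
case: (uv0) => g [pg gv Sg].
have gK z : z \in u0 :: g -> K z by move=> /(allP Sg)/andP[].
have gC z : z \in u0 :: g -> ~~ C z by move=> /(allP Sg)/andP[].
pose Rk z := (z == k) || (fresh w z && w' z).
have Rr2 z : Rk z -> r2 z && w' z.
  case/orP => [/eqP ->|/andP[/and3P[-> _ _] ->]] //.
  by rewrite Kopen // andbT r2v; have := KrL _ Kk; lia.
have [kg|kg] := boolP (k \in u0 :: g).
  exists u0, v; split=> //; apply: conn_trans (conn_sub Rr2 kv).
  have : conn adj (fun z => K z && ~~ C z) u0 k.
    case/splitPl: kg pg Sg => s1 s2 <-; rewrite cat_path -cat_cons all_cat.
    by case/andP=> p1 _ /andP[S1 _]; exists s1.
  apply: conn_sub => z /andP[Kz nCz]; rewrite Kopen // andbT.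
  by rewrite -/(r2 z) r2v; have := KrL _ Kz; lia.
pose G z := (z \in u0 :: g) || (rho z \in u0 :: g).
have [gh [pgh ghv Sgh]] : conn adj G u0 (rho u0).
  apply: (@conn_trans _ _ _ _ v0).
    by exists g; split=> //; apply/allP => z zg; rewrite /G zg.
  have -> : v0 = rho v0 by apply: vertex_eq => //=; lia.
  apply: conn_sym => //; apply: (@conn_map _ _ adj _ rho (fun z => z \in u0 :: g)).
  - by move=> x y _ _; rewrite /adj gadj_refl.
  - by move=> x xg; rewrite /G /rho reflK xg orbT.
  - by exists g; split=> //; apply/allP.
have Gr2 z : z \in u0 :: gh -> 0 <= z.1 <= L + L /\ 0 <= z.2 <= h.
  by move=> /(allP Sgh)/orP[/gK/KrL|/gK/KrL]; rewrite /rho /=; clear; lia.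
have disG z : C z || Rk z -> z \notin u0 :: gh.
  move=> Hz; apply/negP => /(allP Sgh)/orP[zg|zg].
    case/or3P: Hz => [Cz|/eqP zk|/andP[/and3P[_ nKz _] _]].
    - by have := gC _ zg; rewrite Cz.
    - by rewrite -zk zg in kg.
    - by have := gK _ zg; rewrite /K (negbTE nKz).
  case/or3P: Hz => [Cz|/eqP zk|/andP[/and3P[_ _ nKz] _]].
  - by have := gC _ zg; rewrite (rho_axis z (CK _ Cz) (gK _ zg)) Cz.
  - move: kg; rewrite -zk -(rho_axis z) ?zg //; last exact: gK.
    by rewrite zk.
  - by have := gK _ zg; rewrite /K (negbTE nKz).
have inbox z : C z || Rk z -> 0 <= z.1 <= L + L /\ 0 <= z.2 <= h.
  by case/orP => [/CK/KrL|/Rr2/andP[+ _]]; [move: L1; clear; lia | rewrite r2v; clear; lia].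
have [b b2 bv] : exists2 b : vertex, b.2 = 0 & conn adj (fun z => C z || Rk z) b v.
  have kv' : conn adj (fun z => C z || Rk z) k v.
    by apply: conn_sub kv => z Rz; rewrite -/(Rk z) in Rz *; rewrite Rz orbT.
  have := Kk; rewrite /K /explored -/C => /andP[_ /orP[/orP[/eqP k2|/asboolP[c Cc ck]]|Ck]].
  - by exists k.
  - have [a a2 ac] := bottom_cluster_conn Cc; exists a => //.
    apply: (@conn_trans _ _ _ _ c); first by apply: conn_sub ac => z; rewrite -/(C z) => ->.
    apply: conn_trans kv'; apply: conn1 => //; first by rewrite -/(C c) in Cc; rewrite Cc.
    by rewrite /Rk eqxx orbT.
  - by rewrite Ck in nCk.
have offG z : C z || Rk z -> ~~ on_curve u0 gh z.
  move=> Hz; have Bz := inbox _ Hz; have nz := disG _ Hz.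
  rewrite /on_curve (negbTE nz) ghv /=; apply/negP => /orP[zv|zu].
    move/negP: nz; apply; rewrite (_ : z = last u0 gh) ?mem_last // ghv.
    by apply: vertex_eq; move: zv Bz; rewrite /rho /= u01; clear; lia.
  move/negP: nz; apply; rewrite (_ : z = u0) ?mem_head //.
  by apply: vertex_eq; move: zu Bz; rewrite u01; clear; lia.
have Hu0 := KrL _ (gK _ (mem_head _ _)).
have := side_conn pgh offG bv.
have Bb := inbox _ (conn_start bv); have Bv := inbox _ (conn_end bv).
have nv := disG _ (conn_end bv); have nru : v != rho u0.
  by apply: contra nv => /eqP ->; rewrite -ghv mem_last.
rewrite /side ghv parity_under_low; last by move=> x /Gr2; rewrite b2; clear; lia.
have e1 : u0.2 < b.2 = false by move: Hu0; rewrite b2; clear; lia.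
have e2 : v.1 < u0.1 = false by move: Bv; rewrite u01; clear; lia.
rewrite [(rho u0).2]/= e1 e2 !andbF /= addbF.
have [v1|v1] := eqVneq v.1 (L + L); last first.
  rewrite (parity_under_high pgh) //; last first.
    by move=> x /Gr2; case: Hv v1 => [->|[-> _]]; [rewrite eqxx | clear; lia].
  rewrite ghv /rho /= u01.
  have -> : 0 <= v.1 by move: Bv; clear; lia.
  by have -> : L + L - 0 <= v.1 = false by move: Bv v1; clear; lia.
rewrite parity_under_far; last by right=> x /Gr2; rewrite v1; clear; lia.
rewrite /rho /= u01 subr0 v1 lexx /= => /esym vlow.
have {vlow} vlow : v.2 < u0.2.
  have nv2 : v.2 <> u0.2 by move=> E; move/eqP: nru; apply; apply: vertex_eq => //=; rewrite v1 u01 subr0.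
  by move: vlow nv2; clear; lia.
have [||x [y [kx /= xL xy yv]]] := @conn_splitv _ _ (fun z => z.1 <= L) _ _ kv.
- by have [/andP[]] := KrL _ Kk.
- by rewrite /= v1; move: L1; clear; lia.
have Rx : Rk x := conn_end kx.
have {xL} xL : x.1 = L.
  by have := conn_start yv; have := gadj_step xy; move: xL; case: (Rk y) => //=; clear; lia.
pose Z z := Rk z || Rk (rho z).
have xv : conn adj Rk x v.
  apply: (@conn_trans _ _ _ _ y); last by apply: conn_sub yv => z /andP[].
  by apply: conn1 => //; have /andP[] := conn_start yv.
have [q [pq qv Sq]] : conn adj Z (rho v) v.
  apply: (@conn_trans _ _ _ _ x); last by apply: conn_sub xv => z Rz; rewrite /Z Rz.
  have -> : x = rho x by apply: vertex_eq; rewrite /= ?xL //; clear; lia.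
  apply: conn_sym => //; apply: conn_map xv => [a c _ _|a Ra].
    by rewrite /adj gadj_refl.
  by rewrite /Z /rho reflK Ra orbT.
have kL := KrL _ Kk.
have ZC z : C z -> ~~ Z z.
  move=> Cz; apply/negP => /orP[] /orP[/eqP zk|/andP[/and3P[_ nK nK'] _]].
  - by rewrite -zk Cz in nCk.
  - by rewrite -/(K z) CK in nK.
  - by move: nCk; rewrite -zk (rho_axis z) ?Cz ?zk //; apply: CK.
  - by move: nK'; rewrite /rho reflK -/(K z) CK.
have Zu0 : ~~ Z u0.
  have Ku0 := gK _ (mem_head _ _).
  apply/negP => /orP[] /orP[/eqP uk|/andP[/and3P[_ nK nK'] _]].
  - by rewrite -uk mem_head in kg.
  - by rewrite -/(K u0) Ku0 in nK.
  - by have := congr1 (fun z : vertex => z.1) uk; rewrite /rho /= u01; move: kL L1; clear; lia.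
  - by move: nK'; rewrite /rho reflK -/(K u0) Ku0.
have Zr2 z : z \in rho v :: q -> 0 <= z.1 <= L + L /\ 0 <= z.2 <= h.
  by move=> /(allP Sq)/orP[] /Rr2/andP[+ _]; rewrite r2v /rho /=; clear; lia.
have [c Cc cu] : exists2 c, C c & adj c u0.
  have := gK _ (mem_head _ _); rewrite /K /explored => /andP[_ /orP[/orP[/eqP|/asboolP//]|]].
    by move: Bv vlow; clear; lia.
  by move=> Cu; have := gC _ (mem_head _ _); rewrite /C Cu.
have [a a2 ac] := bottom_cluster_conn Cc.
pose W z := [|| C z, z == u0 | z == (-1, u0.2)].
have au : conn adj W a (-1, u0.2).
  apply: (@conn_trans _ _ _ _ c); first by apply: conn_sub ac => z; rewrite /W -/(C z) => ->.
  apply: (@conn_trans _ _ _ _ u0).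
    by apply: conn1 => //; rewrite /W ?Cc ?eqxx ?orbT.
  apply: conn1; rewrite /W ?eqxx ?orbT // /adj /gadj /= u01.
  by rewrite !eqxx /= ?orbT.
have offq z : W z -> ~~ on_curve (rho v) q z.
  move=> Wz; rewrite /on_curve qv; apply/negP => /or3P[zq|zv|zv].
  - have Zz := allP Sq _ zq; case/or3P: Wz => [/ZC|/eqP zu|/eqP zu].
    + by rewrite Zz.
    + by rewrite zu (negbTE Zu0) in Zz.
    + by have := Zr2 _ zq; rewrite zu /=; clear; lia.
  - case/or3P: Wz => [Cz|/eqP zu|/eqP zu]; move: zv; rewrite ?zu /= ?u01 ?v1;
      [|by move: L1; clear; lia|by move: L1; clear; lia].
    by have := KrL _ (CK _ Cz); move: L1; clear; lia.
  - case/or3P: Wz => [Cz|/eqP zu|/eqP zu]; move: zv; rewrite ?zu /= ?u01 ?v1;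
      [|by move: vlow; clear; lia|by move: vlow; clear; lia].
    move=> zv; have zrv : z = rho v.
      by apply: vertex_eq; rewrite /rho /= ?v1; have := KrL _ (CK _ Cz); move: zv; clear; lia.
    have := ZC _ Cz; rewrite zrv /Z /rho reflK (_ : Rk v) ?orbT //.
    exact: conn_end kv.
have Ca := conn_start ac.
have aL := KrL _ (CK _ Ca).
have := side_conn pq offq au.
rewrite /side qv parity_under_low; last by move=> z /Zr2; rewrite a2; clear; lia.
rewrite parity_under_far /=; last by left=> z /Zr2 /=; clear; lia.
rewrite v1.
have -> : L + L <= a.1 = false by move: aL L1; clear; lia.
have -> : L + L <= -1 = false by move: L1; clear; lia.
have -> : a.1 < L + L - (L + L) = false by move: aL; clear; lia.
have -> : -1 < L + L - (L + L) by clear; lia.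
by rewrite vlow.
Qed.

End Exploration.

Lemma conn_agree (T : eqType) (e : rel T) (r : pred T) (D : seq T) (w w' : T -> bool) (u v : T) :
  (forall z : T, r z -> z \in D) -> {in D, w =1 w'} ->
  conn e (fun z => r z && w z) u v -> conn e (fun z => r z && w' z) u v.
Proof.
by move=> rD ww; apply: conn_sub => z /andP[rz wz]; rewrite rz -ww ?wz ?rD.
Qed.

Lemma conn_mono (T : eqType) (e : rel T) (r : pred T) (w w' : T -> bool) (u v : T) :
  (forall z : T, w z -> w' z) ->
  conn e (fun z => r z && w z) u v -> conn e (fun z => r z && w' z) u v.
Proof. by move=> ww; apply: conn_sub => z /andP[-> /ww]. Qed.

Section DoublingProbability.
Variables (R : realFieldType) (L h : int).
Hypotheses (L1 : 1 <= L) (h0 : 0 <= h).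
Implicit Types (u v z : vertex) (w : vertex -> bool).

Let half01 : 0 <= (1 / 2 : R) <= 1. Proof. by lra. Qed.

Lemma lr_cross_supported dg (x0 x1 y0 y1 : int) : x0 <= x1 -> y0 <= y1 ->
  supported (rectl x0 x1 y0 y1) (ind R (lr_cross dg x0 x1 y0 y1)).
Proof.
move=> hx hy; apply: ind_supported => w w' ww [u [v [u1 v1 uv]]].
exists u, v; split=> //; apply: conn_agree ww uv => z rz; by rewrite mem_rectl.
Qed.

Lemma lr_cross_incr dg (x0 x1 y0 y1 : int) : incr (ind R (lr_cross dg x0 x1 y0 y1)).
Proof.
apply: ind_incr => w w' ww [u [v [u1 v1 uv]]].
by exists u, v; split=> //; apply: conn_mono ww uv.
Qed.

Lemma left_to_right_or_top_supported :
  supported (rectl 0 (L + L) 0 h) (ind R (left_to_right_or_top L h)).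
Proof.
apply: ind_supported => w w' ww [u [v [u1 v1 uv]]].
exists u, v; split=> //; apply: conn_agree ww uv => z rz; by rewrite mem_rectl //; lia.
Qed.

Lemma left_to_right_or_top_incr : incr (ind R (left_to_right_or_top L h)).
Proof.
apply: ind_incr => w w' ww [u [v [u1 v1 uv]]].
by exists u, v; split=> //; apply: conn_mono ww uv.
Qed.

Let s2 := rectl 0 (L + L) 0 h.
Let rho := refl L.

Let s2E z : (z \in s2) = rect 0 (L + L) 0 h z.
Proof. by rewrite mem_rectl //; lia. Qed.

Let rho_s2 z : (rho z \in s2) = (z \in s2).
Proof. by rewrite !s2E /rect /rho /=; lia. Qed.

Lemma resample_half w : lr_cross zigzag 0 L 0 h w ->
  1 / 2 <= avg (1 / 2) [seq v <- s2 | ~~ explored L h w v]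
    (ind R (left_to_right_or_top L h)) w.
Proof.
move=> Hw; set K := explored L h w; set s' := [seq v <- s2 | ~~ K v].
pose F := fresh L h w.
pose A w' := exists u v : vertex, [/\ u.2 = 0 /\ u.1 < L + 1,
  v.1 = L + L \/ v.2 = h /\ L <= v.1 &
  conn (gadj zigzag) (fun z => rect 0 (L + L) 0 h z && (K z || (F z && w' z))) u v].
have KrL z : K z -> 0 <= z.1 <= L /\ 0 <= z.2 <= h.
  by move/explored_rL; rewrite /rect => /andP[].
have Frho z : F z = F (rho z).
  by rewrite /F /fresh reflK -!s2E rho_s2; congr andb; apply: andbC.
have nFK z : z \in s2 -> ~~ K z -> ~~ F z -> K (rho z).
  by move=> rz nK; rewrite /F /fresh -s2E rz -/(K z) nK /= negbK.
have AM w' : (forall v, v \notin s' -> w' v = w v) -> A w' ->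
    left_to_right_or_top L h w'.
  move=> ww' [u [v [[u2 u1] Hv uv]]].
  apply: (@explored_to_left L h _ _ w) => //.
    by move=> z Kz; apply: ww'; rewrite mem_filter /K Kz.
  exists u, v; split=> //; last by apply: conn_sub uv => z /andP[_].
  apply: explored_bottom => //.
  by have /andP[] := conn_start uv; rewrite /rect; lia.
apply: (@le_trans _ _ (avg (1 / 2) s' (ind R A) w)); last first.
  by apply: avg_le_on => // w' ww'; apply: ind_le; apply: AM.
have dual w' : A w' \/ A (negc w' \o rho).
  have [| | | | |HA|] := @hex zigzag (fun z => K z || (F z && w' z)) 0 (L + L) 0 h (L + 1) L.
  - by move: L1; clear; lia.
  - by move: L1; clear; lia.
  - by [].
  - move=> x Hx; rewrite /K explored_bottom // /rect /=; move: Hx h0; clear; lia.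
  - move=> x Hx; rewrite negb_or negb_and; apply/andP; split.
      by apply/negP => /KrL /=; move: Hx; clear; lia.
    apply/orP; left; rewrite Frho; apply/negP => /and3P[_ /negP nK _]; apply: nK.
    by apply: explored_bottom; rewrite // /rect /=; move: Hx h0; clear; lia.
  - by left.
  case=> u [v [[u2 u1] Hv uv]]; right.
  exists (rho u), (rho v); split.
  - by split=> //=; move: u1; clear; lia.
  - by move: Hv; rewrite /rho /=; clear; lia.
  apply: conn_map uv => [x y _ _|z]; first by rewrite /rho gadj_refl.
  rewrite -!s2E rho_s2 => /andP[rz]; rewrite rz negb_or negb_and => /andP[nKz].
  rewrite -Frho /negc /= -/rho [rho (rho z)]reflK.
  have [_ /= ->|nF _] := boolP (F z); first by rewrite orbT.
  by rewrite (nFK _ rz nKz nF).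
have Asup : supported [seq v <- s2 | F v] (ind R A).
  apply: ind_supported => w1 w2 ww [u [v [u1 v1 uv]]]; exists u, v; split=> //.
  apply: conn_sub uv => z /andP[rz /orP[Kz|/andP[Fz wz]]]; rewrite rz /= ?Kz //.
  by rewrite Fz -ww ?wz ?orbT // mem_filter Fz s2E rz.
have Fs' : {subset [seq v <- s2 | F v] <= s'}.
  by move=> z; rewrite !mem_filter => /andP[/and3P[_ -> _] ->].
have Fs'' : {subset [seq v <- s2 | F v] <= map rho s'}.
  move=> z; rewrite mem_filter => /andP[Fz sz].
  rewrite -[z](reflK L); apply: map_f; apply: Fs'.
  by rewrite mem_filter -Frho Fz rho_s2.
have E : avg (1 / 2) s' (fun w' => ind R A (negc w' \o rho)) w = avg (1 / 2) s' (ind R A) w.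
  etransitivity; first exact: (avg_negc s' (fun w' => ind R A (w' \o rho)) w).
  rewrite (@avg_bij _ _ _ _ rho); [|exact: reflK|exact: reflK].
  exact: avg_change Asup Fs'' Fs'.
have : avg (1 / 2) s' (fun w' => ind R A w' + ind R A (negc w' \o rho)) w >= 1.
  rewrite -[X in X <= _](congr1 (@^~ w) (avg_cst (1 / 2) s' 1)).
  apply: avg_le => // w'; rewrite /ind.
  by case: (dual w') => /asboolP ->; rewrite ?lerDl ?lerDr ler0n.
rewrite avgD E; set x := avg _ _ _ _; lra.
Qed.

Lemma left_to_right_or_top_prob w :
  1 / 2 * avg (1 / 2) s2 (ind R (lr_cross zigzag 0 L 0 h)) w <=
  avg (1 / 2) s2 (ind R (left_to_right_or_top L h)) w.
Proof.
apply: (@avg_explore _ _ _ (fun w v => explored L h w v)) => // [w1 w2 ww z _|w1].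
  apply: (explored_self (w := w1)) => v Kv; apply: ww; rewrite mem_filter; apply/andP; split=> //.
  by move: (explored_rL Kv); rewrite s2E /rect; lia.
have [H|H] := pselect (lr_cross zigzag 0 L 0 h w1); last first.
  by rewrite /ind asboolF // mulr0; apply: avg_ge0 => // w2; apply: ind_ge0.
apply: le_trans (resample_half H).
by rewrite -[X in _ <= X]mulr1 ler_wpM2l ?ind_le1 //; lra.
Qed.

Lemma doubling_prob w :
  (1 / 2 * avg (1 / 2) (rectl 0 L 0 h) (ind R (lr_cross zigzag 0 L 0 h)) w) ^+ 2 <=
  avg (1 / 2) (rectl 0 (L + L) 0 h) (ind R (lr_cross zigzag 0 (L + L) 0 h)) w.
Proof.
have sub : {subset rectl 0 L 0 h <= s2}.
  by move=> z; rewrite s2E mem_rectl /rect; lia.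
have sup1 : supported (rectl 0 L 0 h) (ind R (lr_cross zigzag 0 L 0 h)).
  by apply: lr_cross_supported; lia.
rewrite (@avg_change _ _ _ _ _ s2 _ w w sup1) //.
have H1 := left_to_right_or_top_prob w.
have supM := left_to_right_or_top_supported.
have H2 : avg (1 / 2) s2 (fun w => ind R (left_to_right_or_top L h) (w \o rho)) w =
    avg (1 / 2) s2 (ind R (left_to_right_or_top L h)) w.
  rewrite (@avg_bij _ _ _ _ rho); [|exact: reflK|exact: reflK].
  apply: avg_change supM _ _ => // z zs; rewrite -[z](reflK L); apply: map_f.
  by rewrite rho_s2.
have incM := left_to_right_or_top_incr.
have incM' : incr (fun w => ind R (left_to_right_or_top L h) (w \o rho)).
  by move=> w1 w2 ww; apply: incM => v; apply: ww.
have := harris half01 s2 w incM incM'; rewrite H2 => H3.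
apply: le_trans (le_trans H3 _); last first.
  apply: avg_le => // w1; rewrite (indI R _ (fun w1 => left_to_right_or_top L h (w1 \o rho))).
  by apply: ind_le => -[]; apply: glue_crossings.
rewrite expr2; apply: ler_pM => //; rewrite mulr_ge0 //; first [lra | apply: avg_ge0 => // ?; exact: ind_ge0].
Qed.

End DoublingProbability.

Definition straight (_ : int) : bool := true.

Notation tri := (gadj straight).

Definition swap (v : vertex) : vertex := (v.2, v.1).

Lemma swapK : involutive swap. Proof. by case. Qed.

Lemma tri_swap u v : tri (swap u) (swap v) = tri u v.
Proof. by case: u v => [a b] [c d]; rewrite /gadj /=; lia. Qed.

(* [unshear] and [shear] exchange the two descriptions of the lattice. *)
Definition shear (v : vertex) : vertex := (v.1, v.2 + (v.1 %/ 2)%Z).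
Definition unshear (v : vertex) : vertex := (v.1, v.2 - (v.1 %/ 2)%Z).

Lemma shearK : cancel shear unshear.
Proof. by move=> v; apply: vertex_eq => //=; lia. Qed.

Lemma unshearK : cancel unshear shear.
Proof. by move=> v; apply: vertex_eq => //=; lia. Qed.

Lemma zigzag_shear u v : gadj zigzag (shear u) (shear v) = tri u v.
Proof.
case: u v => [a b] [c d]; rewrite /gadj /shear /zigzag /=.
by case: ifP; case: ifP; lia.
Qed.

Definition shift (c v : vertex) : vertex := (v.1 + c.1, v.2 + c.2).
Definition unshift (c v : vertex) : vertex := (v.1 - c.1, v.2 - c.2).

Lemma shiftK c : cancel (shift c) (unshift c).
Proof. by move=> v; apply: vertex_eq => /=; lia. Qed.

Lemma unshiftK c : cancel (unshift c) (shift c).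
Proof. by move=> v; apply: vertex_eq => /=; lia. Qed.

Lemma tri_unshift c u v : tri (unshift c u) (unshift c v) = tri u v.
Proof. by case: u v => [x y] [x' y']; rewrite /gadj /=; lia. Qed.

Lemma zigzag_shift (a b : int) u v :
  gadj zigzag (shift (a + a, b) u) (shift (a + a, b) v) = gadj zigzag u v.
Proof.
case: u v => [x y] [x' y']; rewrite /gadj /zigzag /=.
by case: ifP; case: ifP; case: ifP; case: ifP; lia.
Qed.

Lemma strip_blocks dg (S S' : pred vertex) (x0 x1 y0 y1 : int) (a b : vertex) :
  lr_cross dg x0 x1 y0 y1 S' -> (forall z, S z -> ~~ S' z) ->
  (forall z, S z -> x0 < z.1 < x1) -> a.2 <= y0 -> y1 <= b.2 ->
  conn (gadj dg) S a b -> False.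
Proof.
move=> [u [v [u1 v1 [s [ps sv Ss]]]]] dis Sx a2 b2 ab.
have rs (z : vertex) : z \in u :: s -> (x0 <= z.1 <= x1) && (y0 <= z.2 <= y1).
  by move=> /(allP Ss)/andP[].
have disP z : S z -> z \notin u :: s.
  by move=> Sz; apply/negP => /(allP Ss)/andP[_]; apply/negP; apply: dis.
have off z : S z -> ~~ on_curve u s z.
  move=> Sz; rewrite /on_curve (negbTE (disP _ Sz)) sv /= u1 v1.
  by have := Sx _ Sz; clear; lia.
have := side_conn ps off ab.
have ru := rs _ (mem_head _ _); have rv := rs v; rewrite -{1}sv mem_last in rv.
have {}rv := rv isT.
have Ha := Sx _ (conn_start ab); have Hb := Sx _ (conn_end ab).
rewrite /side parity_under_low; last by move=> x /rs; move: a2; clear; lia.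
rewrite (parity_under_high ps); last 2 first.
- exact: disP (conn_end ab).
- by move=> x /rs; move: b2; clear; lia.
rewrite sv u1 v1.
have -> : x1 <= a.1 = false by move: Ha; clear; lia.
have -> : a.1 < x0 = false by move: Ha; clear; lia.
have -> : x1 <= b.1 = false by move: Hb; clear; lia.
have -> : b.1 < x0 = false by move: Hb; clear; lia.
by have -> : x0 <= b.1 by move: Hb; clear; lia.
Qed.

Section Probability.
Variable R : realFieldType.

Let half01 : 0 <= (1 / 2 : R) <= 1. Proof. by lra. Qed.

Lemma avg_transport (T : eqType) (p : R) (D s : seq T) (f : (T -> bool) -> R) (sigma tau : T -> T) w w' :
  cancel sigma tau -> cancel tau sigma -> supported D f -> {subset map sigma D <= s} ->
  avg p s (fun w => f (w \o sigma)) w = avg p D f w'.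
Proof.
move=> st ts sf Ds; rewrite (avg_bij _ _ _ _ st ts).
apply: avg_change sf _ _ => // z zD; rewrite -[z]st; apply: map_f.
by apply: Ds; apply: map_f.
Qed.

Lemma supported_comp (T : eqType) (D : seq T) (f : (T -> bool) -> R) (sigma : T -> T) :
  supported D f -> supported (map sigma D) (fun w => f (w \o sigma)).
Proof. by move=> sf w w' ww; apply: sf => z zD /=; apply: ww; apply: map_f. Qed.

Lemma lr_cross_swap (a b : int) w : a <= b ->
  lr_cross straight a b a b w <-> ~ lr_cross straight a b a b (negc w \o swap).
Proof.
move=> ab; split=> [[u [v [u1 v1 uv]]] [u' [v' [u1' v1' uv']]]|nH].
  have uv2 : conn tri (fun z => rect a b a b z && negc w z) (swap u') (swap v').
    apply: conn_map uv' => [x y _ _|x]; first by rewrite tri_swap.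
    by rewrite /rect /= => /andP[/andP[-> ->] ->].
  have [z wz] := @lr_meets_bt _ w (negc w) _ _ _ _ _ _ (swap u') (swap v') u1 v1 u1' v1' uv uv2.
  by rewrite /negc wz.
have [//|[u [v [u2 v2 uv]]]] := @hex_lr straight w a b a b ab ab.
case: nH; exists (swap u), (swap v); split=> //.
apply: conn_map uv => [x y _ _|x]; first by rewrite tri_swap.
rewrite /rect /negc /= swapK; by case: (w x); rewrite /= ?andbF // !andbT andbC.
Qed.

Lemma square_half (a b : int) w : a <= b ->
  avg (1 / 2) (rectl a b a b) (ind R (lr_cross straight a b a b)) w = 1 / 2.
Proof.
move=> ab; set s := rectl a b a b; set f := ind R _.
have sf : supported s f by apply: lr_cross_supported.
have E : avg (1 / 2) s (fun w => f (negc w \o swap)) w = avg (1 / 2) s f w.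
  etransitivity; first exact: (avg_negc s (fun w' => f (w' \o swap)) w).
  apply: avg_transport => //; [exact: swapK | exact: swapK |].
  by move=> z /mapP[x xs ->]; move: xs; rewrite !mem_rectl // /rect /=; lia.
have : avg (1 / 2) s (fun w => f w + f (negc w \o swap)) w = 1.
  rewrite -[RHS](congr1 (@^~ w) (avg_cst (1 / 2) s 1)); congr avg; apply: funext => x.
  have [H H'] := lr_cross_swap x ab; rewrite /f /ind.
  case: asboolP => A; case: asboolP => B; rewrite ?addr0 ?add0r //.
    by case: (H A).
  by case: A; apply: H'.
by rewrite avgD E => H; lra.
Qed.

Lemma zigzag_cross_init (k : int) w : 0 <= k ->
  1 / 2 <= avg (1 / 2) (rectl 0 (4 * k) 0 (6 * k)) (ind R (lr_cross zigzag 0 (4 * k) 0 (6 * k))) w.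
Proof.
move=> k0; have k40 : 0 <= 4 * k by lia.
rewrite -[X in X <= _](square_half w k40).
set s := rectl 0 _ _ (6 * k); set s' := rectl _ _ _ _.
have sup' : supported s' (ind R (lr_cross straight 0 (4 * k) 0 (4 * k))).
  exact: lr_cross_supported.
rewrite (@avg_change _ _ _ _ _ (s' ++ map unshear s) _ w w sup') //; last first.
  by move=> z zs; rewrite mem_cat zs.
have sup : supported s (ind R (lr_cross zigzag 0 (4 * k) 0 (6 * k))).
  by apply: lr_cross_supported => //; lia.
rewrite -(@avg_transport _ _ s (s' ++ map unshear s) _ _ _ w w unshearK shearK sup); last first.
  by move=> z zs; rewrite mem_cat zs orbT.
apply: avg_le => // w1; apply: ind_le => -[u [v [u1 v1 uv]]].
exists (shear u), (shear v); split=> //.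
apply: conn_map uv => [x y _ _|x]; first by rewrite zigzag_shear.
by rewrite /= shearK => /andP[+ ->]; rewrite andbT /rect /=; lia.
Qed.

Definition strip_prob : R := ((1 / 2) ^+ 11) ^+ 2.

Lemma zigzag_strip (k : int) w : 1 <= k ->
  strip_prob <= avg (1 / 2) (rectl 0 (32 * k) 0 (6 * k))
    (ind R (lr_cross zigzag 0 (32 * k) 0 (6 * k))) w.
Proof.
move=> k1; have k6 : 0 <= 6 * k by lia.
have step (x : R) (L : int) : 0 <= x -> 1 <= L ->
    x <= avg (1 / 2) (rectl 0 L 0 (6 * k)) (ind R (lr_cross zigzag 0 L 0 (6 * k))) w ->
    (1 / 2 * x) ^+ 2 <= avg (1 / 2) (rectl 0 (L + L) 0 (6 * k))
       (ind R (lr_cross zigzag 0 (L + L) 0 (6 * k))) w.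
  move=> x0 L1 Hx; apply: le_trans (doubling_prob _ L1 k6 w).
  rewrite !expr2; apply: ler_pM; rewrite ?mulr_ge0 ?ler_wpM2l //; lra.
have l1 : 1 <= 4 * k by move: k1; clear; lia.
have l2 : 1 <= 4 * k + 4 * k by move: k1; clear; lia.
have l3 : 1 <= 4 * k + 4 * k + (4 * k + 4 * k) by move: k1; clear; lia.
have H0 := @zigzag_cross_init k w ltac:(move: k1; clear; lia).
have H1 := step _ _ (proj1 (andP half01)) l1 H0.
have H2 := step _ _ (sqr_ge0 _) l2 H1.
have H3 := step _ _ (sqr_ge0 _) l3 H2.
have E : 4 * k + 4 * k + (4 * k + 4 * k) + (4 * k + 4 * k + (4 * k + 4 * k)) = 32 * k.
  by clear; lia.
rewrite E in H3; apply: le_trans H3; rewrite le_eqVlt; apply/orP; left; apply/eqP.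
by rewrite /strip_prob; congr (_ ^+ 2); field.
Qed.

End Probability.

(** * One-arm estimate *)

Definition top_strip (k : int) (w : vertex -> bool) : Prop :=
  lr_cross zigzag (- (16 * k)) (16 * k) k (7 * k) (w \o unshear).
Definition bottom_strip (k : int) (w : vertex -> bool) : Prop :=
  lr_cross zigzag (- (16 * k)) (16 * k) (- (7 * k)) (- k) (w \o unshear).

(* Four long crossings around the origin; the strips are straight in the
   Euclidean picture and parallel to [(2, -1)] or [(-1, 2)]. *)
Definition barrier (k : int) (w : vertex -> bool) : Prop :=
  (top_strip k w /\ bottom_strip k w) /\
  (top_strip k (w \o swap) /\ bottom_strip k (w \o swap)).

Definition height (v : vertex) : int := v.2 + (v.1 %/ 2)%Z.

Lemma strips_block (k : int) w (S : pred vertex) (u v : vertex) :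
  top_strip k (negc w) -> bottom_strip k (negc w) ->
  (forall z, S z -> w z && (`|z.1| < 16 * k)) ->
  `|height u| < k -> 7 * k <= `|height v| -> conn tri S u v -> False.
Proof.
move=> Ht Hb Sw hu hv uv.
have uv' : conn (gadj zigzag) (S \o unshear) (shear u) (shear v).
  by apply: conn_map uv => [x y _ _|x]; rewrite ?zigzag_shear //= shearK.
have dis z : (S \o unshear) z -> ~~ (negc w \o unshear) z.
  by move=> /Sw/andP[wz _]; rewrite /negc /= negbK.
have Sx z : (S \o unshear) z -> - (16 * k) < z.1 < 16 * k.
  by move=> /Sw/andP[_] /=; clear; lia.
have [H|H] := lerP (7 * k) (height v).
  apply: (strip_blocks Ht dis Sx _ _ uv'); last exact: H.
  by move: hu; rewrite /height /=; clear; lia.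
apply: (strip_blocks Hb dis Sx _ _ (conn_sym (@gadj_sym zigzag) uv')).
  by move: hv H; rewrite /height /=; clear; lia.
by move: hu; rewrite /height /=; clear; lia.
Qed.

Lemma height_adj u v : tri u v -> `|height u - height v| <= 1.
Proof. by rewrite /gadj /height /=; lia. Qed.

Lemma barrier_blocks (k : int) w (u v : vertex) : 2 <= k -> barrier k (negc w) ->
  `|height u| < k -> `|height (swap u)| < k -> 16 * k <= `|v.1| ->
  conn tri w u v -> False.
Proof.
move=> k2 [[Ht Hb] [Ht' Hb']] hu hu' hv uv.
pose Q (z : vertex) := (`|height z| < 7 * k) && (`|height (swap z)| < 7 * k).
have Qx (z : vertex) : `|height z| <= 7 * k -> `|height (swap z)| <= 7 * k ->
    (`|z.1| < 16 * k) /\ (`|z.2| < 16 * k).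
  by rewrite /height /=; move: k2; clear; lia.
have Qu : Q u by apply/andP; split; [move: hu|move: hu']; move: k2; clear; lia.
have [||x [y [vx nQx xy yu]]] := @conn_splitv _ _ (fun z => ~~ Q z) _ _
  (conn_sym (@gadj_sym straight) uv).
- by apply/negP => /andP[] /ltW h1 /ltW h2; have := Qx _ h1 h2; move: hv; clear; lia.
- by rewrite Qu.
have wx : w x := conn_end vx.
have Qy : Q y by have /andP[_ ] := conn_start yu; rewrite negbK.
have xh := height_adj xy.
have xh' : `|height (swap x) - height (swap y)| <= 1 by apply: height_adj; rewrite tri_swap.
pose S z := w z && (`|height z| <= 7 * k) && (`|height (swap z)| <= 7 * k).
have Sx : S x.
  rewrite /S wx /=; case/andP: Qy => h1 h2.
  by apply/andP; split; [move: h1 xh | move: h2 xh']; clear; lia.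
have SS z : w z && ~~ ~~ Q z -> S z.
  by rewrite negbK /S => /and3P[-> /ltW -> /ltW ->].
have ux : conn tri S u x.
  apply: conn_sym; first exact: gadj_sym.
  apply: (@conn_trans _ _ _ _ y); last exact: conn_sub SS yu.
  by apply: conn1 => //; apply: SS; apply: conn_start yu.
have Sw z : S z -> w z && (`|z.1| < 16 * k) && (`|z.2| < 16 * k).
  by case/andP => /andP[-> h1] h2; have [-> ->] := Qx _ h1 h2.
move: nQx; rewrite negb_and -!leNgt => /orP[hx|hx].
  by apply: (strips_block Ht Hb _ hu hx ux) => z /Sw/andP[].
have ux' : conn tri (S \o swap) (swap u) (swap x).
  by apply: conn_map ux => [a b _ _|a]; rewrite ?tri_swap //= swapK.
apply: (strips_block (w := w \o swap) Ht' Hb' _ hu' hx ux') => z /Sw/andP[/andP[wz _] hz].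
by rewrite /= wz.
Qed.

Section ArmProbability.
Variable R : realFieldType.

Implicit Types (k : int) (z u v : vertex).

Let half01 : 0 <= (1 / 2 : R) <= 1. Proof. by lra. Qed.

Definition big_box (k : int) : seq vertex := rectl (- (16 * k)) (16 * k) (- (16 * k)) (16 * k).

Definition annulus (k : int) : seq vertex :=
  [seq z <- big_box k | (k <= `|height z|) || (k <= `|height (swap z)|)].

Lemma mem_big_box k z : 0 <= k -> (z \in big_box k) = (`|z.1| <= 16 * k) && (`|z.2| <= 16 * k).
Proof. by move=> k0; rewrite mem_rectl /rect; lia. Qed.

Lemma mem_annulus k z : 0 <= k -> (z \in annulus k) =
  [&& `|z.1| <= 16 * k, `|z.2| <= 16 * k & (k <= `|height z|) || (k <= `|height (swap z)|)].
Proof. by move=> k0; rewrite mem_filter mem_big_box // andbC andbA. Qed.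

Lemma top_strip_supported k : 1 <= k -> supported (annulus k) (ind R (top_strip k)).
Proof.
move=> k1; apply: ind_supported => w w' ww [u [v [u1 v1 uv]]].
exists u, v; split=> //; apply: conn_sub uv => z /andP[rz]; rewrite rz /= ww //.
by rewrite mem_annulus; move: k1 rz; rewrite /rect /height /=; clear; lia.
Qed.

Lemma bottom_strip_supported k : 1 <= k -> supported (annulus k) (ind R (bottom_strip k)).
Proof.
move=> k1; apply: ind_supported => w w' ww [u [v [u1 v1 uv]]].
exists u, v; split=> //; apply: conn_sub uv => z /andP[rz]; rewrite rz /= ww //.
by rewrite mem_annulus; move: k1 rz; rewrite /rect /height /=; clear; lia.
Qed.

Lemma swap_annulus k z : 0 <= k -> (swap z \in annulus k) = (z \in annulus k).
Proof. by move=> k0; rewrite !mem_annulus // swapK /=; clear; lia. Qed.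

Lemma supported_mul D (f g : (vertex -> bool) -> R) :
  supported D f -> supported D g -> supported D (fun w => f w * g w).
Proof. by move=> sf sg w w' ww; rewrite (sf w w') // (sg w w'). Qed.

Lemma supported_swap k (f : (vertex -> bool) -> R) : 0 <= k ->
  supported (annulus k) f -> supported (annulus k) (fun w => f (w \o swap)).
Proof.
move=> k0 /(supported_comp (sigma := swap)); apply: supportedS => z /mapP[x xa ->].
by rewrite swap_annulus.
Qed.

Lemma ind_barrierE k w : ind R (barrier k) w =
  (ind R (top_strip k) w * ind R (bottom_strip k) w) *
  (ind R (top_strip k) (w \o swap) * ind R (bottom_strip k) (w \o swap)).
Proof.
by rewrite !indI -[ind R _ (w \o swap)]/(ind R (fun w => top_strip k (w \o swap)
  /\ bottom_strip k (w \o swap)) w) indI.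
Qed.

Lemma barrier_supported k : 1 <= k -> supported (annulus k) (ind R (barrier k)).
Proof.
move=> k1; have k0 : 0 <= k by lia.
rewrite (funext (ind_barrierE k)); apply: supported_mul.
  apply: supported_mul; [exact: top_strip_supported|exact: bottom_strip_supported].
apply: supported_mul; apply: supported_swap => //;
  [exact: top_strip_supported|exact: bottom_strip_supported].
Qed.

Lemma strip_incr (k : int) y0 y1 :
  incr (fun w => ind R (lr_cross zigzag (- (16 * k)) (16 * k) y0 y1) (w \o unshear)).
Proof. by move=> w w' ww; apply: lr_cross_incr => v; apply: ww. Qed.

Lemma barrier_prob k w : 1 <= k ->
  strip_prob R ^+ 4 <= avg (1 / 2) (big_box k) (ind R (barrier k)) w.
Proof.
move=> k1; have k0 : 0 <= k by lia.
have strip b : b = k \/ b = - (7 * k) -> strip_prob R <= avg (1 / 2) (big_box k)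
    (fun w => ind R (lr_cross zigzag (- (16 * k)) (16 * k) b (b + 6 * k)) (w \o unshear)) w.
  move=> hb; apply: le_trans (zigzag_strip R w k1) _.
  pose sg := shift (- (8 * k) + - (8 * k), b); pose tu := unshift (- (8 * k) + - (8 * k), b).
  rewrite -(@avg_transport _ _ _ _ (big_box k) _ (unshear \o sg) (tu \o shear) w w).
  - apply: avg_le => // w1; apply: ind_le => -[u [v [u1 v1 uv]]].
    exists (sg u), (sg v); split; [rewrite /= u1; lia|rewrite /= v1; lia|].
    apply: conn_map uv => [x y _ _|x]; first by rewrite zigzag_shift.
    by rewrite /= => /andP[+ ->]; rewrite andbT /rect /=; clear; lia.
  - by move=> z; rewrite -[RHS](shiftK (- (8 * k) + - (8 * k), b)); congr unshift; apply: unshearK.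
  - by move=> z; rewrite -[RHS]shearK; congr unshear; apply: unshiftK.
  - by apply: lr_cross_supported; lia.
  - move=> z /mapP[x xs ->]; move: xs; rewrite mem_big_box // mem_rectl; [|lia|lia].
    by rewrite /rect /=; move: k1 hb; clear; lia.
have top : strip_prob R <= avg (1 / 2) (big_box k) (ind R (top_strip k)) w.
  have := strip k (or_introl erefl); rewrite (_ : k + 6 * k = 7 * k) //; by lia.
have bot : strip_prob R <= avg (1 / 2) (big_box k) (ind R (bottom_strip k)) w.
  have := strip (- (7 * k)) (or_intror erefl); rewrite (_ : - (7 * k) + 6 * k = - k) //; by lia.
have Ab : {subset annulus k <= big_box k} by move=> z; rewrite mem_filter => /andP[].
have sw (f : (vertex -> bool) -> R) : supported (annulus k) f ->
    avg (1 / 2) (big_box k) (fun w => f (w \o swap)) w = avg (1 / 2) (big_box k) f w.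
  move=> sf; apply: (avg_transport _ _ _ swapK swapK (supportedS Ab sf)).
  by move=> z /mapP[x xb ->]; move: xb; rewrite !mem_big_box //= andbC.
have it : incr (ind R (top_strip k)) := @strip_incr k _ _.
have ib : incr (ind R (bottom_strip k)) := @strip_incr k _ _.
pose f1 w := ind R (top_strip k) w * ind R (bottom_strip k) w.
have E1 : strip_prob R ^+ 2 <= avg (1 / 2) (big_box k) f1 w.
  apply: le_trans (harris half01 _ _ it ib); rewrite expr2.
  by apply: ler_pM => //; apply: sqr_ge0.
have i1 : incr f1.
  by move=> w1 w2 ww; apply: ler_pM; rewrite ?ind_ge0 //; [apply: it | apply: ib].
have i2 : incr (fun w => f1 (w \o swap)) by move=> w1 w2 ww; apply: i1 => v; apply: ww.
rewrite (funext (ind_barrierE k)); apply: le_trans (harris half01 _ _ i1 i2).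
rewrite sw; last first.
  by apply: supported_mul; [exact: top_strip_supported|exact: bottom_strip_supported].
rewrite -[4%N]/(2 + 2)%N exprD.
by apply: ler_pM => //; apply: sqr_ge0.
Qed.

Definition arm_rate : R := 1 - strip_prob R ^+ 4.

Lemma arm_rate01 : 1 / 2 <= arm_rate < 1.
Proof.
rewrite /arm_rate /strip_prob -!exprM.
have h : 0 < (1 / 2 : R) by lra.
have h1 : (1 / 2 : R) ^+ (11 * 2 * 4) <= 1 / 2.
  rewrite -[X in _ <= X]expr1; apply: ler_wiXn2l; [lra | lra | by []].
have h2 : 0 < (1 / 2 : R) ^+ (11 * 2 * 4) by rewrite exprn_gt0.
by move: h1 h2; set x := _ ^+ _; lra.
Qed.

Definition barrier_scale (i : nat) : int := (2 * 32 ^ i)%N%:Z.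

Definition no_barrier (c : vertex) (m : nat) (w : vertex -> bool) : R :=
  \prod_(i < m) (1 - ind R (barrier (barrier_scale i)) (negc w \o shift c)).

Lemma no_barrier_prob c m s w :
  (forall i, (i < m)%N -> {subset map (shift c) (big_box (barrier_scale i)) <= s}) ->
  avg (1 / 2) s (no_barrier c m) w <= arm_rate ^+ m.
Proof.
have sc1 i : 1 <= barrier_scale i.
  have : (0 < 32 ^ i)%N by rewrite expn_gt0.
  by rewrite /barrier_scale; lia.
have gsup i : supported (map (shift c) (annulus (barrier_scale i)))
    (fun w => 1 - ind R (barrier (barrier_scale i)) (negc w \o shift c)).
  move=> w1 w2 ww; congr (1 - _); apply: (barrier_supported (sc1 i)) => z za.
  by rewrite /negc /= ww //; apply: map_f.
elim: m => [|m IH] Hs.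
  have -> : no_barrier c 0 = fun _ => 1 by apply: funext => x; rewrite /no_barrier big_ord0.
  by rewrite avg_cst.
have -> : no_barrier c m.+1 = fun w => no_barrier c m w *
    (1 - ind R (barrier (barrier_scale m)) (negc w \o shift c)).
  by apply: funext => x; rewrite /no_barrier big_ord_recr.
have p_ge0 x : 0 <= no_barrier c m x.
  by apply: prodr_ge0 => i _; rewrite subr_ge0 ind_le1.
have fsup : supported (flatten [seq map (shift c) (annulus (barrier_scale i)) | i <- iota 0 m])
    (no_barrier c m).
  move=> w1 w2 ww; apply: eq_bigr => i _; apply: gsup => z zi; apply: ww.
  by apply/flatten_mapP; exists (i : nat) => //; rewrite mem_iota /=.
have sub i : (i < m.+1)%N -> {subset map (shift c) (annulus (barrier_scale i)) <= s}.
  move=> im z /mapP[x]; rewrite mem_filter => /andP[_ xb] ->.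
  by apply: Hs im _ _; apply: map_f.
rewrite (avg_prod _ _ fsup (gsup m)); last 2 first.
- exact: sub.
- move=> z /flatten_mapP[i]; rewrite mem_iota /= => im /mapP[x xa ->].
  apply/negP => /mapP[y ya /(can_inj (shiftK c)) xy]; move: xa ya; rewrite -{}xy.
  have sc0 j : 0 <= barrier_scale j by apply: le_trans (sc1 j).
  rewrite !mem_annulus //.
  have : 32 * barrier_scale i <= barrier_scale m.
    have := leq_pexp2l (isT : (0 < 32)%N) im; rewrite expnSr /barrier_scale.
    by move: (expn 32 i) (expn 32 m) => a b; clear; lia.
  by move: (sc1 i); rewrite /height /=; clear; lia.
rewrite exprSr; apply: ler_pM.
- exact: avg_ge0.
- by apply: avg_ge0 => // x; rewrite subr_ge0 ind_le1.
- by apply: IH => i im; apply: Hs; apply: ltnW.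
have -> : avg (1 / 2) s (fun x => 1 - ind R (barrier (barrier_scale m)) (negc x \o shift c)) w =
    1 - avg (1 / 2) s (fun x => ind R (barrier (barrier_scale m)) (negc x \o shift c)) w.
  transitivity (avg (1 / 2) s (fun x => (fun=> 1) x + -1 * ind R (barrier (barrier_scale m)) (negc x \o shift c)) w).
    by congr avg; apply: funext => x; rewrite mulN1r.
  by rewrite avgD avgZ avg_cst mulN1r.
rewrite /arm_rate lerB // (avg_negc s (fun x => ind R (barrier (barrier_scale m)) (x \o shift c))).
have bsup : supported (big_box (barrier_scale m)) (ind R (barrier (barrier_scale m))).
  by apply: supportedS (barrier_supported (sc1 m)) => z; rewrite mem_filter => /andP[].
rewrite (avg_transport _ _ w (shiftK c) (unshiftK c) bsup); last exact: Hs.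
exact: barrier_prob.
Qed.

Definition arm_event (r : pred vertex) (c : vertex) (j : int) (w : vertex -> bool) : Prop :=
  exists u v : vertex, [/\ tri c u, j <= `|v.1 - c.1| & conn tri (fun z => r z && w z) u v].

Lemma arm_incr r c j : incr (ind R (arm_event r c j)).
Proof.
apply: ind_incr => w w' ww [u [v [u1 v1 uv]]].
by exists u, v; split=> //; apply: conn_mono ww uv.
Qed.

Lemma arm_prob (p : R) (D : seq vertex) c m (s : seq vertex) w : 0 <= p <= 1 / 2 -> {subset D <= s} ->
  avg p s (ind R (arm_event (fun z => z \in D) c (32 ^ m)%N%:Z)) w <= arm_rate ^+ m.
Proof.
case/andP => p0 p12 Ds; set f := ind R _.
have sf : supported D f.
  apply: ind_supported => w1 w2 ww [u [v [cu cv uv]]].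
  by exists u, v; split=> //; apply: conn_agree ww uv.
pose s' := s ++ flatten [seq map (shift c) (big_box (barrier_scale i)) | i <- iota 0 m].
have Ds' : {subset D <= s'} by move=> z zD; rewrite mem_cat Ds.
rewrite (avg_change p w w sf Ds Ds').
apply: le_trans (avg_le_param _ _ p0 p12 _ (@arm_incr _ _ _)) _; first lra.
apply: le_trans (@no_barrier_prob c m s' w _); last first.
  move=> i im z zi; rewrite mem_cat; apply/orP; right; apply/flatten_mapP.
  by exists i => //; rewrite mem_iota.
apply: avg_le => // x; rewrite {1}/ind; case: asboolP => [[u [v [cu cv uv]]]|_]; last first.
  by apply: prodr_ge0 => i _; rewrite subr_ge0 ind_le1.
rewrite /no_barrier big1 // => i _; rewrite /ind asboolF ?subr0 // => B.
have uv' : conn tri (x \o shift c) (unshift c u) (unshift c v).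
  by apply: conn_map uv => [a b _ _|a /andP[_]]; rewrite ?tri_unshift //= unshiftK.
have u0 : tri (0, 0) (unshift c u).
  by rewrite -(tri_unshift c) /unshift !subrr in cu.
have sc2 : 2 <= barrier_scale i.
  have : (0 < 32 ^ i)%N by rewrite expn_gt0.
  by rewrite /barrier_scale; clear; lia.
apply: (barrier_blocks (k := barrier_scale i) sc2 B _ _ _ uv').
- by have := height_adj u0; rewrite {1}/height /=; move: sc2; clear; lia.
- have u0' : tri (0, 0) (swap (unshift c u)) by rewrite -(tri_swap (0, 0)) in u0.
  by have := height_adj u0'; rewrite {1}/height /=; move: sc2; clear; lia.
have := leq_pexp2l (isT : (0 < 32)%N) (ltn_ord i); rewrite expnSr.
by move: cv; rewrite /barrier_scale /=; move: (expn 32 i) (expn 32 m) => a b; clear; lia.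
Qed.

End ArmProbability.

(** * Revealment and influences *)

Section ClusterExploration.
Variables (T : eqType) (adj : rel T) (S : seq T) (start : pred T) (f : (T -> bool) -> bool).
Implicit Types (w : T -> bool) (known opened : seq T).

Definition reached w v : bool :=
  `[< exists2 a, start a & conn adj (fun z => (z \in S) && w z) a v >].

Hypothesis f_mono : forall w w', (forall v, w v -> w' v) -> f w -> f w'.
Hypothesis f_reached : forall w, f w -> f (reached w).

Definition candidates known opened :=
  [seq v <- S | (v \notin known) && (start v || has (adj^~ v) opened)].

Fixpoint explore (n : nat) known opened : dtree T :=
  match n, candidates known opened with
  | n'.+1, v :: _ =>
      Query v (explore n' (v :: known) (v :: opened)) (explore n' (v :: known) opened)
  | _, _ => Leaf T (f (fun v => v \in opened))
  end.

Lemma candidate_head known opened v vs : candidates known opened = v :: vs ->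
  [/\ v \in S, v \notin known & start v || has (adj^~ v) opened].
Proof.
move=> E; have : v \in candidates known opened by rewrite E mem_head.
by rewrite mem_filter => /andP[/andP[]].
Qed.

Lemma explore_sites n known opened v :
  v \in sites (explore n known opened) -> (v \in S) && (v \notin known).
Proof.
elim: n known opened => [|n IH] known opened //=.
case E : (candidates known opened) => [|x xs] //=.
have [xS xk _] := candidate_head E.
rewrite in_cons mem_cat => /or3P[/eqP ->|/IH|/IH]; first by rewrite xS.
  by rewrite in_cons negb_or => /andP[-> /andP[]].
by rewrite in_cons negb_or => /andP[-> /andP[]].
Qed.

Lemma explore_read_once n known opened : read_once (explore n known opened).
Proof.
elim: n known opened => [|n IH] known opened //=.
case E : (candidates known opened) => [|x xs] //=.
rewrite !IH !andbT; apply/andP; split; apply/negP => /explore_sites;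
  by rewrite mem_head andbF.
Qed.

Lemma reached_step w u v : reached w u -> v \in S -> w v -> adj u v -> reached w v.
Proof.
move=> /asboolP[a sa au] vS wv uv; apply/asboolP; exists a => //.
apply: conn_trans (au) _; apply: conn1 uv; last by rewrite vS.
exact: conn_end au.
Qed.

Lemma explore_queried n known opened w v :
  {in opened, forall u, reached w u} -> v \in queried (explore n known opened) w ->
  start v \/ exists2 u, adj u v & reached w u.
Proof.
elim: n known opened => [|n IH] known opened //=.
case E : (candidates known opened) => [|x xs] //= Ho.
have [xS xk /orP Hx] := candidate_head E.
have {Hx} Hx : start x \/ exists2 u, adj u x & reached w u.
  case: Hx => [->|/hasP[u uo ux]]; first by left.
  by right; exists u => //; apply: Ho.
rewrite in_cons => /orP[/eqP -> //|]; case: ifP => wx; apply: IH => // u.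
rewrite in_cons => /orP[/eqP -> {u}|/Ho //].
case: Hx => [sx|[u ux ru]]; last exact: reached_step ru _ _ ux.
by apply/asboolP; exists x => //; apply: conn_refl; rewrite xS.
Qed.

Lemma explore_value n known opened w :
  (size S <= n + size known)%N -> uniq known -> {subset known <= S} ->
  {subset opened <= known} -> {in known, forall v, (v \in opened) = w v} ->
  value (explore n known opened) w = f w.
Proof.
have leaf known' opened' : candidates known' opened' = [::] -> {subset known' <= S} ->
    {subset opened' <= known'} -> {in known', forall v, (v \in opened') = w v} ->
    f (fun v => v \in opened') = f w.
  move=> C kS ok kw.
  have ncand v : v \in S -> start v || has (adj^~ v) opened' -> v \in known'.
    move=> vS Hv; apply: contraT => vk.
    have : v \in candidates known' opened' by rewrite mem_filter vk Hv.
    by rewrite C.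
  apply/idP/idP; first by apply: f_mono => v vo; rewrite -kw //; apply: ok.
  move/f_reached; apply: f_mono => v /asboolP[a sa].
  apply: (conn_ind_end (Q := fun v => v \in opened')) => [/andP[aS wa]|x y xo _ /andP[yS wy] xy].
    by rewrite kw // ncand // sa.
  rewrite kw //; apply: ncand => //; apply/orP; right.
  by apply/hasP; exists x.
elim: n known opened => [|n IH] known opened sz uk kS ok kw.
  apply: (leaf known opened) => //; case E : (candidates known opened) => [|x xs]; first by [].
  have [xS xk _] := candidate_head E.
  have H : (size (x :: known) <= size S)%N.
    apply: uniq_leq_size; first by rewrite /= xk.
    by move=> u; rewrite in_cons => /orP[/eqP ->|/kS].
  by move: (leq_trans H sz); rewrite ltnn.
rewrite /=; case E : (candidates known opened) => [|x xs]; first exact: leaf E kS ok kw.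
have [xS xk _] := candidate_head E; rewrite /=.
have kS' : {subset x :: known <= S}.
  by move=> u; rewrite in_cons => /orP[/eqP ->|/kS].
have xo : x \notin opened by apply: contra xk; apply: ok.
case: ifP => wx; apply: IH => //=; rewrite ?xk ?addnS //.
- by move=> u; rewrite !in_cons => /orP[->//|/ok ->]; rewrite orbT.
- move=> u; rewrite !in_cons => /orP[/eqP ->|uk']; first by rewrite eqxx wx.
  by case: eqP => [ux|_] //=; [rewrite -ux uk' in xk | exact: kw].
- by move=> u /ok; rewrite in_cons => ->; rewrite orbT.
- move=> u; rewrite !in_cons => /orP[/eqP ->|/kw //].
  by rewrite (negbTE xo) wx.
Qed.

End ClusterExploration.

Section Independence.
Variables (T : eqType) (R : realFieldType).

Lemma avg_all_closed (p : R) (s : seq T) w : uniq s ->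
  avg p s (fun w => \prod_(v <- s) (~~ w v)%:R) w = (1 - p) ^+ size s.
Proof.
elim: s w => [|v s IH] w /=; first by rewrite big_nil.
case/andP=> vs us.
have -> : avg p s (fun w => \prod_(u <- v :: s) (~~ w u)%:R) =
    fun w => (~~ w v)%:R * (1 - p) ^+ size s.
  under [X in avg _ _ X]funext => x do rewrite big_cons.
  rewrite avgMl; first by apply: funext => x; rewrite IH.
  by move=> u us' x b; rewrite /upd; case: eqP => // vu; rewrite vu us' in vs.
by rewrite /avg1 !upd_same /= mul0r mulr0 add0r mul1r exprS.
Qed.

Lemma avg_all_open (p : R) (s : seq T) w : uniq s ->
  avg p s (fun w => \prod_(v <- s) (w v)%:R) w = p ^+ size s.
Proof.
elim: s w => [|v s IH] w /=; first by rewrite big_nil.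
case/andP=> vs us.
have -> : avg p s (fun w => \prod_(u <- v :: s) (w u)%:R) =
    fun w => (w v)%:R * p ^+ size s.
  under [X in avg _ _ X]funext => x do rewrite big_cons.
  rewrite avgMl; first by apply: funext => x; rewrite IH.
  by move=> u us' x b; rewrite /upd; case: eqP => // vu; rewrite vu us' in vs.
by rewrite /avg1 !upd_same /= mul0r mulr0 addr0 mul1r exprS.
Qed.

Lemma prod_bool (s : seq T) (b : pred T) : \prod_(v <- s) (b v)%:R = (all b s)%:R :> R.
Proof.
elim: s => [|v s IH]; first by rewrite big_nil.
by rewrite big_cons IH /=; case: (b v); rewrite ?mul1r ?mul0r.
Qed.

End Independence.

Section Revealment.
Variables (R : realFieldType) (p : R) (n : nat).
Hypotheses (hp : 0 < p <= 1 / 2) (n1 : (1 <= n)%N).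
Implicit Types (w : vertex -> bool) (u v z : vertex) (k : int).

Let a : int := n%:Z - 1.
Definition inner : seq vertex := rectl (- a) a (- a) a.
Definition crossed w : bool := `[< lr_cross straight (- a) a (- a) a w >].

Let p01 : 0 <= p <= 1. Proof. by case/andP: hp => *; lra. Qed.
Let a0 : - a <= a. Proof. by move: n1; rewrite /a; clear; lia. Qed.

Lemma mem_inner z : (z \in inner) = rect (- a) a (- a) a z.
Proof. exact: mem_rectl. Qed.

Definition column k : pred vertex := fun z => z.1 == k.

Lemma crossed_mono w w' : (forall v, w v -> w' v) -> crossed w -> crossed w'.
Proof.
move=> ww /asboolP[u [v [u1 v1 uv]]]; apply/asboolP.
by exists u, v; split=> //; apply: conn_mono ww uv.
Qed.

Lemma crossed_reached k w : - a <= k <= a -> crossed w ->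
  crossed (reached tri inner (column k) w).
Proof.
move=> hk /asboolP[u [v [u1 v1 uv]]]; apply/asboolP; exists u, v; split=> //.
have [x [x1 ux]] : exists x : vertex, x.1 = k /\
    conn tri (fun z => rect (- a) a (- a) a z && w z) u x.
  have [vk|vk] := eqVneq v.1 k; first by exists v.
  have [||x [y [ux xk xy yv]]] := @conn_splitv _ _ (fun z => z.1 <= k) _ _ uv.
  - by move: u1 hk; clear; lia.
  - by move: v1 hk vk; clear; lia.
  exists x; split=> //; have := conn_start yv; move: (gadj_step xy) xk => /=.
  by case: (_ && w y); clear; lia.
have xu := conn_sym (@gadj_sym straight) ux.
have : conn tri (fun z => (rect (- a) a (- a) a z && w z) && reached tri inner (column k) w z) u v.
  apply: conn_inv uv => [_|z t rz _ /andP[rt wt] zt].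
    apply/asboolP; exists x; first by rewrite /column x1.
    by apply: conn_sub xu => z; rewrite mem_inner.
  by apply: reached_step rz _ wt zt; rewrite mem_inner.
by apply: conn_sub => z /andP[/andP[-> _]].
Qed.

Definition column_tree k := explore tri inner (column k) crossed (size inner) [::] [::].

Lemma column_tree_value k w : - a <= k <= a -> value (column_tree k) w = crossed w.
Proof.
move=> hk; apply: explore_value => //; rewrite ?addn0 //.
- exact: crossed_mono.
- by move=> w'; apply: crossed_reached.
Qed.

Definition revealment k u w : R :=
  avg p inner (fun w => (u \in queried (column_tree k) w)%:R) w.

Definition crossing_prob w : R := avg p inner (fun w => (crossed w)%:R) w.

Definition infl u w : R := influence p inner (fun w => (crossed w)%:R) u w.

Lemma crossed_supported : supported inner (fun w => (crossed w)%:R : R).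
Proof. exact: lr_cross_supported. Qed.

Lemma osss_column k w : - a <= k <= a ->
  crossing_prob w * (1 - crossing_prob w) <= p * (1 - p) * \sum_(u <- inner) revealment k u w * infl u w.
Proof.
move=> hk.
have H := @osss _ R p p01 inner (column_tree k) (fun w => (crossed w)%:R) w _ _ _ _ _.
have E1 : (fun w => (value (column_tree k) w)%:R) = (fun w => (crossed w)%:R) :> (_ -> R).
  by apply: funext => x; rewrite column_tree_value.
have E2 : (fun w => (value (column_tree k) w)%:R * (crossed w)%:R) = (fun w => (crossed w)%:R) :> (_ -> R).
  by apply: funext => x; rewrite column_tree_value //; case: (crossed x); rewrite ?mulr1 ?mulr0.
rewrite E1 E2 in H; rewrite mulrBr mulr1; apply: H.
- by move=> x; case: (crossed x); rewrite ?lexx ?ler01.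
- exact: uniq_rectl.
- exact: explore_read_once.
- by move=> u /explore_sites /andP[].
- by move=> x y; apply: (avg_const _ _ _ crossed_supported).
Qed.

Lemma revealment_le1 k u w : revealment k u w <= 1.
Proof. by apply: avg_le1 => // x; rewrite lern1 leq_b1. Qed.

Lemma queried_reached k u w : u \in queried (column_tree k) w -> u.1 != k ->
  exists2 z, tri z u & reached tri inner (column k) w z.
Proof.
move=> uq uk; have [] := explore_queried _ uq; last by [].
  by move=> ?; rewrite in_nil.
by move/eqP => E; rewrite E eqxx in uk.
Qed.

Lemma revealment_arm k u w m : u.1 != k -> (32 ^ m)%N%:Z <= `|k - u.1| ->
  revealment k u w <= arm_rate R ^+ m.
Proof.
move=> uk hm; apply: le_trans (@arm_prob R p inner u m inner w _ _) => //; last first.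
  by case/andP: hp => *; apply/andP; split; lra.
apply: avg_le => // x; rewrite /ind.
case: (boolP (u \in _)) => uq; last by rewrite ler0n.
rewrite asboolT //.
have [z zu /asboolP[c ck cz]] := queried_reached uq uk.
exists z, c; split; first by rewrite gadj_sym.
  by rewrite (eqP ck).
by apply: conn_sym => //; apply: gadj_sym.
Qed.

Lemma revealment_lt1 k u w : u.1 != k -> revealment k u w <= 1 - (1 - p) ^+ size inner.
Proof.
move=> uk; rewrite -(avg_all_closed p w (uniq_rectl _ _ _ _)).
rewrite lerBrDr -avgD -[X in _ <= X](congr1 (@^~ w) (avg_cst p inner 1)).
apply: avg_le => // x; rewrite (prod_bool _ _ (fun v => ~~ x v)).
case: (boolP (u \in _)) => uq; last by rewrite add0r lern1 leq_b1.
have [z zu /asboolP[c ck cz]] := queried_reached uq uk.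
have /andP[zi xz] := conn_end cz.
case: allP => [/(_ z zi)|]; last by rewrite addr0.
by rewrite xz.
Qed.

Definition nth_column (i : nat) : int := i%:Z - a.

Lemma nth_column_in i : (i < 2 * n - 1)%N -> - a <= nth_column i <= a.
Proof. by rewrite /nth_column /a; lia. Qed.

Lemma crossing_prob_le w : crossing_prob w <= p.
Proof.
case/andP: hp => p0 p12; apply: avg_half_le => //.
- exact: lr_cross_incr.
- by move=> x; case: (crossed x); [right|left].
- by rewrite (square_half R w a0).
Qed.

Lemma crossing_prob_gt0 w : 0 < crossing_prob w.
Proof.
case/andP: hp => p0 p12.
have : 0 < p ^+ size inner by rewrite exprn_gt0.
move/lt_le_trans; apply; rewrite -(avg_all_open p w (uniq_rectl _ _ _ _)).
apply: avg_le => // x; rewrite prod_bool ler_nat; case: allP => //= H.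
rewrite lt0b; apply/asboolP.
have [//|[u [v [_ _ /conn_start/andP[ru nu]]]]] := @hex_lr straight x (- a) a (- a) a a0 a0.
by rewrite H ?mem_inner in nu.
Qed.

Lemma infl_lower (M : R) w :
  (forall u, u \in inner -> \sum_(i < 2 * n - 1) revealment (nth_column i) u w <= M) ->
  crossing_prob w * (2 * n - 1)%:R <= M * (p * \sum_(u <- inner) infl u w).
Proof.
move=> HM; have q0 : 0 < 1 - p by case/andP: hp => *; lra.
have infl0 u : 0 <= infl u w by apply: avg_ge0.
have H1 : \sum_(i < 2 * n - 1) (crossing_prob w * (1 - crossing_prob w)) <=
    \sum_(i < 2 * n - 1) (p * (1 - p) * \sum_(u <- inner) revealment (nth_column i) u w * infl u w).
  by apply: ler_sum => i _; apply: osss_column; apply: nth_column_in.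
rewrite sumr_const card_ord -mulr_natr -mulr_sumr exchange_big /= in H1.
have H2 : \sum_(u <- inner) \sum_(i < 2 * n - 1) revealment (nth_column i) u w * infl u w
    <= \sum_(u <- inner) M * infl u w.
  rewrite !big_seq; apply: ler_sum => u ui; rewrite -mulr_suml.
  by apply: ler_wpM2r => //; apply: HM.
rewrite -mulr_sumr in H2; set I := \sum_(u <- inner) infl u w in H2 *.
have HF := crossing_prob_le w; have F0 := ltW (crossing_prob_gt0 w).
have H3 : crossing_prob w * (2 * n - 1)%:R * (1 - p) <= M * (p * I) * (1 - p).
  apply: (@le_trans _ _ (crossing_prob w * (1 - crossing_prob w) * (2 * n - 1)%:R)).
    rewrite -!mulrA; apply: ler_wpM2l => //; rewrite mulrC; apply: ler_wpM2r => //.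
    lra.
  apply: le_trans H1 _; rewrite (_ : M * (p * I) * (1 - p) = p * (1 - p) * (M * I)); last by ring.
  by apply: ler_wpM2l => //; case/andP: hp => *; rewrite mulr_ge0 ?ltW.
by rewrite ler_pM2r in H3.
Qed.

Lemma revealment_sum1 u w : \sum_(i < 2 * n - 1) revealment (nth_column i) u w <= (2 * n - 1)%:R.
Proof.
rewrite -[X in _ <= X%:R]card_ord -sumr_const; apply: ler_sum => i _.
exact: revealment_le1.
Qed.

Lemma revealment_sum_lt u w : (2 <= n)%N ->
  \sum_(i < 2 * n - 1) revealment (nth_column i) u w <= (2 * n - 1)%:R - (1 - p) ^+ size inner.
Proof.
move=> n2; have [i Hi] : exists i : 'I_(2 * n - 1), u.1 != nth_column i.
  have h0 : (0 < 2 * n - 1)%N by lia.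
  have h1 : (1 < 2 * n - 1)%N by lia.
  have [E|] := eqVneq u.1 (nth_column 0); last by move=> H; exists (Ordinal h0).
  by exists (Ordinal h1); rewrite E /nth_column /=; lia.
rewrite (bigD1 i) //=.
apply: (@le_trans _ _ ((1 - (1 - p) ^+ size inner) + \sum_(j < 2 * n - 1 | j != i) 1)).
  apply: lerD; first exact: revealment_lt1.
  by apply: ler_sum => j _; apply: revealment_le1.
have : \sum_(j < 2 * n - 1) (1 : R) = (2 * n - 1)%:R.
  by rewrite sumr_const card_ord.
by rewrite (bigD1 i) //= => <-; rewrite addrAC.
Qed.

Lemma count_near (N A J : nat) :
  (\sum_(i < N) (A < i + J) && (i < A + J) <= 2 * J)%N.
Proof.
have -> : (\sum_(i < N) (A < i + J) && (i < A + J) = minn N (A + J) - (A.+1 - J))%N.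
  elim: N => [|N IH]; first by rewrite big_ord0 min0n.
  by rewrite big_ord_recr /= IH; case: (A < N + J)%N / idP; case: (N < A + J)%N / idP; lia.
lia.
Qed.

Lemma revealment_sum_arm u w m : u \in inner ->
  \sum_(i < 2 * n - 1) revealment (nth_column i) u w <=
  (2 * 32 ^ m)%:R + (2 * n - 1)%:R * arm_rate R ^+ m.
Proof.
rewrite mem_inner /rect => ui; pose A := `|(u.1 + a)%R|%N.
apply: (@le_trans _ _ (\sum_(i < 2 * n - 1)
   (((A < i + 32 ^ m) && (i < A + 32 ^ m))%N%:R + arm_rate R ^+ m))).
  apply: ler_sum => i _.
  have r0 : 0 <= arm_rate R ^+ m.
    by apply: exprn_ge0; have /andP[] := arm_rate01 R; lra.
  case: (boolP (_ && _)) => [_|H]; first by apply: le_trans (revealment_le1 _ _ _) _; rewrite lerDl.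
  rewrite add0r; have e0 : (0 < 32 ^ m)%N by rewrite expn_gt0.
  by apply: revealment_arm; move: H e0 ui; rewrite /A /nth_column /a; clear; lia.
rewrite big_split /= sumr_const card_ord -[_ *+ (2 * n - 1)]mulr_natl lerD2r.
by rewrite -natr_sum ler_nat count_near.
Qed.

End Revealment.

(** * Choice of the exponent *)

Section Exponent.
Variable R : realType.

Lemma powR_small (c d : R) : 1 <= c -> 1 < d ->
  exists2 a0 : R, 0 < a0 & forall a, 0 < a <= a0 -> c `^ a <= d.
Proof.
move=> c1 d1; have lc : 0 <= ln c by rewrite ln_ge0.
have ld : 0 < ln d by rewrite ln_gt0.
exists (ln d / (1 + ln c)); first by rewrite divr_gt0 // ltr_pwDl.
move=> a /andP[a0 ha]; rewrite /powR; case: eqP => [c0|_]; first by rewrite c0 ler10 in c1.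
rewrite -[X in _ <= X](lnK (x := d)); last by rewrite posrE; lra.
rewrite ler_expR.
have : a * (1 + ln c) <= ln d by rewrite -ler_pdivlMr // ltr_pwDl.
apply: le_trans; rewrite mulrDr mulr1; by rewrite lerDr ltW.
Qed.

Lemma geometric_small (k e : R) : 0 < k < 1 -> 0 < e ->
  exists m0 : nat, forall m, (m0 <= m)%N -> k ^+ m <= e.
Proof.
case/andP=> k0 k1 e0.
have H : (fun m => k ^+ m) @ \oo --> (0 : R) by apply: cvg_expr; rewrite gtr0_norm.
have /cvgrPdist_le /(_ e e0) [m0 _ Hm] := H.
exists m0 => m mm; have := Hm m mm; rewrite /= sub0r normrN.
by apply: le_trans; apply: ler_norm.
Qed.

Lemma exponent_choice (b : nat) (theta : R) (eps : nat -> R) : (2 <= b)%N -> 1 / 2 <= theta < 1 ->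
  (forall n, 0 < eps n <= 1) ->
  exists2 alpha : R, 0 < alpha & forall n : nat, (2 <= n)%N ->
    n%:R `^ alpha * ((2 * n - 1)%:R - eps n) <= (2 * n - 1)%:R \/
    exists m, n%:R `^ alpha * ((2 * b ^ m)%:R + (2 * n - 1)%:R * theta ^+ m) <= (2 * n - 1)%:R.
Proof.
move=> b2 /andP[t0 t1] heps; pose kappa := (1 + theta) / 2.
have [m0 Hm0] := @geometric_small kappa (1 / 6) ltac:(rewrite /kappa; lra) ltac:(lra).
have bb1 : 1 <= (b * b)%:R :> R by rewrite ler1n muln_gt0 andbb ltnW.
have [a1 a10 Ha1] := @powR_small (b * b)%:R (kappa / theta) bb1
  ltac:(rewrite ltr_pdivlMr /kappa; lra).
have [a2 a20 Ha2] := @powR_small (b * b)%:R 2 bb1 ltac:(lra).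
have [a3 a30 Ha3] : exists2 a3 : R, 0 < a3 & forall a, 0 < a <= a3 ->
    forall n, (2 <= n)%N -> (n < (b * b) ^ m0)%N ->
    n%:R `^ a * ((2 * n - 1)%:R - eps n) <= (2 * n - 1)%:R.
  move: ((b * b) ^ m0)%N => N; elim: N => [|N [a3 a30 IH]]; first by exists 1.
  have [N2|N2] := ltnP N 2.
    by exists a3 => // a Ha n n2 nN; move: N2 n2 nN; clear; lia.
  have /andP[e0 e1] := heps N.
  have d0 : 2 <= (2 * N - 1)%:R :> R by rewrite ler_nat; move: N2; clear; lia.
  have [a4 a40 Ha4] := @powR_small N%:R ((2 * N - 1)%:R / ((2 * N - 1)%:R - eps N))
    ltac:(by rewrite ler1n ltnW) ltac:(rewrite ltr_pdivlMr; lra).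
  exists (Num.min a3 a4); first by rewrite lt_min a30.
  move=> a /andP[a0]; rewrite le_min => /andP[aa3 ab] n n2.
  rewrite ltnS leq_eqVlt => /orP[/eqP ->|nN]; last by apply: IH; rewrite ?a0.
  by rewrite -ler_pdivlMr; [apply: Ha4; rewrite a0 | lra].
exists (Num.min a1 (Num.min a2 a3)); first by rewrite !lt_min a10 a20.
set al := Num.min _ _.
have al0 : 0 < al by rewrite !lt_min a10 a20.
have l1 : al <= a1 by rewrite /al ge_min lexx.
have l2 : al <= a2 by rewrite /al !ge_min lexx orbT.
have l3 : al <= a3 by rewrite /al !ge_min lexx !orbT.
move=> n n2; have [nN|nN] := ltnP n ((b * b) ^ m0).
  by left; apply: Ha3; rewrite ?al0.
right; pose m := trunc_log (b * b) n; exists m.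
have /andP[nm nm'] : ((b * b) ^ m <= n < (b * b) ^ m.+1)%N.
  by apply: trunc_log_bounds; rewrite ?(ltnW n2) //; move: b2; clear; nia.
have mm : (m0 <= m)%N by apply: trunc_log_max nN; move: b2; clear; nia.
set B := (b * b)%:R `^ al.
have B0 : 0 <= B by apply: powR_ge0.
have B1 : B <= kappa / theta by apply: Ha1; rewrite al0.
have B2 : B <= 2 by apply: Ha2; rewrite al0.
have nB : n%:R `^ al <= B ^+ m.+1.
  have -> : B ^+ m.+1 = ((b * b) ^ m.+1)%N%:R `^ al.
    by rewrite natrX -(powR_mulrn _ B0) -(powR_mulrn m.+1 (ler0n R (b * b))) /B -!powRrM mulrC.
  by apply: ge0_ler_powR; rewrite ?nnegrE ?ler0n ?ler_nat; [exact: ltW | | | exact: ltnW].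
have nn : n%:R <= (2 * n - 1)%:R :> R by rewrite ler_nat; move: n2; clear; lia.
set N := (2 * n - 1)%:R in nn *.
have N0 : 0 <= N by rewrite ler0n.
have tm0 : 0 <= theta ^+ m by apply: exprn_ge0; lra.
have tm : (2 * b ^ m)%:R <= 2 * (N * theta ^+ m).
  rewrite natrM ler_pM2l // natrX.
  have h1 : 1 <= b%:R ^+ m * theta ^+ m.
    rewrite -exprMn; apply: exprn_ege1; rewrite -ler_pdivrMr; last lra.
    by apply: (@le_trans _ _ 2); [rewrite ler_pdivrMr; lra | rewrite ler_nat].
  apply: (@le_trans _ _ (b%:R ^+ m * (b%:R ^+ m * theta ^+ m))).
    by rewrite ler_peMr // exprn_ge0.
  rewrite mulrA; apply: ler_wpM2r => //; apply: le_trans nn.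
  by rewrite -exprMn -natrM -natrX ler_nat.
have Bt : (B * theta) ^+ m <= 1 / 6.
  apply: le_trans (Hm0 m mm); apply: lerXn2r; rewrite ?nnegrE.
  - by rewrite mulr_ge0 //; lra.
  - by rewrite /kappa; lra.
  - by rewrite -ler_pdivlMr //; lra.
apply: (@le_trans _ _ (B ^+ m.+1 * (3 * (N * theta ^+ m)))).
  apply: ler_pM; [exact: powR_ge0 | | exact: nB |].
    by rewrite addr_ge0 ?ler0n // mulr_ge0.
  by move: tm; set x := N * _; lra.
rewrite (_ : B ^+ m.+1 * (3 * (N * theta ^+ m)) = 3 * N * (B * (B * theta) ^+ m)); last first.
  by rewrite exprMn exprS; ring.
apply: (@le_trans _ _ (3 * N * (2 * (1 / 6)))); last by lra.
apply: ler_wpM2l; first by rewrite mulr_ge0.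
by apply: ler_pM => //; apply: exprn_ge0; rewrite mulr_ge0 //; lra.
Qed.

End Exponent.

(** * Pivotal vertices *)

Lemma nbr_tri : nbr =2 tri.
Proof.
move=> [a b] [c d]; rewrite /nbr /gadj /= !inE !xpair_eqE; lia.
Qed.

Lemma nbr_sym : symmetric nbr.
Proof. by move=> u v; rewrite !nbr_tri gadj_sym. Qed.

Lemma is_path_rev s : is_path (rev s) = is_path s.
Proof.
rewrite /is_path rev_uniq rev_sorted; congr (_ && _).
by apply: eq_sorted => u v; rewrite nbr_sym.
Qed.

Lemma is_path_cat s t : is_path (s ++ t) -> is_path s && is_path t.
Proof.
rewrite /is_path cat_uniq => /andP[/and3P[-> _ ->] /=].
by move/cat_sorted2 => [-> ->].
Qed.

Section Pivotal.
Variable n : nat.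
Hypothesis n1 : (1 <= n)%N.
Implicit Types (w : config) (u v : vertex).

Let a : int := n%:Z - 1.

Lemma open_box_rect v : open_box n v = rect (- a) a (- a) a v.
Proof. by rewrite /open_box /rect /a; lia. Qed.

Lemma simple_conn (S : pred vertex) u v : conn tri S u v ->
  exists s, [/\ is_path (u :: s), last u s = v & all S (u :: s)].
Proof.
move=> [s [ps sv Ss]]; case/shortenP: ps sv => s' ps' us' ss' sv'.
exists s'; split=> //.
  by rewrite /is_path us' /= (eq_path nbr_tri).
apply/allP => z; rewrite in_cons => zs; apply: (allP Ss); rewrite in_cons.
by case/orP: zs => [->//|/ss' ->]; rewrite orbT.
Qed.

Lemma extend_path u (s : seq vertex) x y : is_path (u :: s) ->
  all (open_box n) (u :: s) -> ~~ open_box n x -> ~~ open_box n y -> x != y ->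
  nbr x u -> nbr (last u s) y -> is_path (x :: rcons (u :: s) y).
Proof.
move=> /andP[us ps] os ox oy xy xu sy; rewrite /is_path.
have ns z : ~~ open_box n z -> z \notin u :: s by apply: contra => /(allP os).
rewrite cons_uniq rcons_uniq us (ns _ oy) mem_rcons in_cons negb_or xy (ns _ ox) /=.
by rewrite xu rcons_path sy andbT.
Qed.

Lemma split_path x (s1 : seq vertex) v (s2 : seq vertex) y :
  is_path (x :: rcons (s1 ++ v :: s2) y) ->
  [/\ is_path (v :: rcons (rev s1) x), is_path (v :: rcons s2 y) &
   {in rcons (rev s1) x, forall u, u \notin rcons s2 y}].
Proof.
rewrite (_ : x :: _ = (x :: s1) ++ v :: rcons s2 y); last by rewrite rcons_cat.
move=> P; split.
- have : is_path (rcons (x :: s1) v ++ rcons s2 y) by rewrite cat_rcons.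
  by move/is_path_cat/andP => [+ _]; rewrite -is_path_rev rev_rcons rev_cons.
- by have /is_path_cat/andP[] := P.
- move=> u; rewrite mem_rcons in_cons mem_rev => us.
  move: P; rewrite /is_path cat_uniq => /andP[/and3P[_ /hasPn H _] _].
  apply/negP => us2; have := H u; rewrite in_cons us2 orbT => /(_ isT).
  by rewrite in_cons us.
Qed.

Lemma lr_event_crossed w : lr_event n w -> crossed n w.
Proof.
move=> [s [x [q [y [-> /andP[_ pq] /andP[bx /eqP x1] /andP[by_ /eqP y1] oq]]]]].
case: q pq oq => [|u q] /=.
  by rewrite andbT nbr_tri => /gadj_step; rewrite x1 y1; lia.
rewrite rcons_path => /andP[xu /andP[uq qy]] /andP[/andP[ou wu] oq].
apply/asboolP; exists u, (last u q).
have ol : open_box n (last u q).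
  have : last u q \in u :: q by apply: mem_last.
  by rewrite in_cons => /orP[/eqP ->//|/(allP oq)/andP[]].
split.
- by move: xu; rewrite nbr_tri => /gadj_step; move: ou; rewrite /open_box x1; lia.
- by move: qy; rewrite nbr_tri => /gadj_step; move: ol; rewrite /open_box y1; lia.
exists q; split=> //; first by rewrite -(eq_path nbr_tri).
rewrite /= -open_box_rect ou wu; apply: sub_all oq => z.
by rewrite -open_box_rect.
Qed.

Lemma crossed_lr_event w : crossed n w -> lr_event n w.
Proof.
move=> /asboolP[u [v [u1 v1 /simple_conn[s [ps sv Ss]]]]].
pose x : vertex := (- n%:Z, u.2); pose y : vertex := (n%:Z, v.2).
have Os : all (open_box n) (u :: s) by apply: sub_all Ss => z /andP[]; rewrite open_box_rect.
have ou : open_box n u by case/andP: Os.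
have ov : open_box n v by rewrite -sv; apply: (allP Os); apply: mem_last.
exists (x :: rcons (u :: s) y), x, (u :: s), y; split=> //.
- apply: extend_path => //.
  + by rewrite /open_box /x /= ltxx.
  + by rewrite /open_box /y /= ltxx andbF.
  + by rewrite xpair_eqE /=; apply/negP => /andP[/eqP]; lia.
  + by rewrite nbr_tri /gadj /x /= u1 /a; lia.
  + by rewrite sv nbr_tri /gadj /y /= v1 /a; lia.
- by move: ou; rewrite /left_side /box /open_box /x /=; lia.
- by move: ov; rewrite /right_side /box /open_box /y /=; lia.
- by apply: sub_all Ss => z /andP[]; rewrite open_box_rect => -> ->.
Qed.

Lemma part_of_arm (side : pred vertex) g v (s : seq vertex) y :
  is_path (v :: rcons s y) -> side y -> all (fun x => box n x && (x \notin g)) (rcons s y) ->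
  forall u, u \in rcons s y -> part n side g u.
Proof.
move=> ps sy sg u us; case/splitPr: us ps sg (last_rcons v s y) => s1 s2.
rewrite -cat_cons => /is_path_cat/andP[_ p2]; rewrite all_cat => /andP[_ a2].
by rewrite last_cat /= => l2; exists s2; split=> //; rewrite l2.
Qed.

Lemma pivotalP w v : open_box n v -> w v ->
  crossed n w -> ~~ crossed n (upd w v false) -> pivotal n w v.
Proof.
move=> ov wv cw ncw; split=> //; split=> //.
have /asboolP[p0 [p1 [p01 p11 p0p1]]] := cw.
have [P [pP lP aP]] := simple_conn p0p1.
have vP : v \in p0 :: P.
  apply: contraNT ncw => nv; apply/asboolP; exists p0, p1; split=> //.
  exists P; split=> //; first by case/andP: pP => _ /=; rewrite (eq_path nbr_tri).
  apply/allP => z zP; have /andP[-> wz] := allP aP _ zP; rewrite /upd /=.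
  by case: eqP => // zv; rewrite -zv zP in nv.
have aa : - a <= a by move: n1; rewrite /a; clear; lia.
have [H|[c0 [c1 [c01 c11 c0c1]]]] := @hex_lr straight (upd w v false) (- a) a (- a) a aa aa.
  by case/negP: ncw; apply/asboolP.
have [Q [pQ lQ aQ]] := simple_conn c0c1.
have vQ : v \in c0 :: Q.
  apply: contraT => nv.
  have [|z wz nwz] := @lr_meets_bt straight w (fun z => ~~ w z) _ _ _ _ _ _ c0 c1
    p01 p11 c01 c11 p0p1; last by rewrite wz in nwz.
  exists Q; split=> //; first by case/andP: pQ => _ /=; rewrite (eq_path nbr_tri).
  apply/allP => z zQ; have /andP[->] := allP aQ _ zQ; rewrite /upd /=.
  by case: eqP => // zv; rewrite -zv zQ in nv.
pose x : vertex := (- n%:Z, p0.2); pose y : vertex := (n%:Z, p1.2).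
pose x' : vertex := (c0.1, - n%:Z); pose y' : vertex := (c1.1, n%:Z).
have oP : all (open_box n) (p0 :: P) by apply: sub_all aP => z /andP[]; rewrite open_box_rect.
have oQ : all (open_box n) (c0 :: Q) by apply: sub_all aQ => z /andP[]; rewrite open_box_rect.
have op0 : open_box n p0 by case/andP: oP.
have oc0 : open_box n c0 by case/andP: oQ.
have op1 : open_box n p1 by rewrite -lP; apply: (allP oP); apply: mem_last.
have oc1 : open_box n c1 by rewrite -lQ; apply: (allP oQ); apply: mem_last.
have nx : ~~ open_box n x by rewrite /open_box /x /= ltxx.
have ny : ~~ open_box n y by rewrite /open_box /y /= ltxx andbF.
have nx' : ~~ open_box n x' by rewrite /open_box /x' /= ltxx andbF.
have ny' : ~~ open_box n y' by rewrite /open_box /y' /= ltxx !andbF.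
have xPy : is_path (x :: rcons (p0 :: P) y).
  apply: extend_path => //.
  - by rewrite xpair_eqE /=; apply/negP => /andP[/eqP]; move: n1; clear; lia.
  - by rewrite nbr_tri /gadj /x /= p01 /a; clear; lia.
  - by rewrite lP nbr_tri /gadj /y /= p11 /a; clear; lia.
have xQy : is_path (x' :: rcons (c0 :: Q) y').
  apply: extend_path => //.
  - by rewrite xpair_eqE /=; apply/negP => /andP[_ /eqP]; move: n1; clear; lia.
  - by rewrite nbr_tri /gadj /x' /= c01 /a; clear; lia.
  - by rewrite lQ nbr_tri /gadj /y' /= c11 /a; clear; lia.
have lsx : left_side n x by move: op0; rewrite /left_side /box /open_box /x /=; clear; lia.
have rsy : right_side n y by move: op1; rewrite /right_side /box /open_box /y /=; clear; lia.
have bsx : bottom_side n x' by move: oc0; rewrite /bottom_side /box /open_box /x' /=; clear; lia.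
have tsy : top_side n y' by move: oc1; rewrite /top_side /box /open_box /y' /=; clear; lia.
have xx' : x' != x by rewrite xpair_eqE; apply/negP; move: oc0; rewrite /open_box; clear; lia.
have xy' : x' != y by rewrite xpair_eqE; apply/negP; move: oc0; rewrite /open_box; clear; lia.
have yx' : y' != x by rewrite xpair_eqE; apply/negP; move: oc1; rewrite /open_box; clear; lia.
have yy' : y' != y by rewrite xpair_eqE; apply/negP; move: oc1; rewrite /open_box; clear; lia.
have wP : all (fun u => open_box n u && w u) (p0 :: P).
  by apply: sub_all aP => z; rewrite -open_box_rect.
have [A [B EP]] : exists A B, p0 :: P = A ++ v :: B.
  by case/splitPr: vP => A B; exists A, B.
have [C [D EQ]] : exists C D, c0 :: Q = C ++ v :: D.
  by case/splitPr: vQ => C D; exists C, D.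
rewrite {}EP in xPy wP; rewrite {}EQ in xQy aQ pQ.
have [pA pB dAB] := split_path xPy; have [pC pD dCD] := split_path xQy.
have gE : rev (rcons (rev A) x) ++ v :: rcons B y = x :: rcons (A ++ v :: B) y.
  by rewrite rev_rcons revK rcons_cat.
have box_open z : open_box n z -> box n z by rewrite /open_box /box; clear; lia.
have /andP[uQ _] := pQ.
have wQ z : (z \in C) || (z \in D) -> open_box n z && ~~ w z.
  move=> zCD; have zQ : z \in C ++ v :: D.
    by rewrite mem_cat in_cons; case/orP: zCD => ->; rewrite ?orbT.
  have := allP aQ _ zQ; rewrite -open_box_rect /upd; case: eqP => // zv.
  move: uQ; rewrite zv in zCD; rewrite cat_uniq /= => /and3P[_ /norP[nC _] /andP[nD _]].
  by rewrite (negbTE nC) (negbTE nD) in zCD.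
have offg z : open_box n z && ~~ w z -> box n z && (z \notin x :: rcons (A ++ v :: B) y).
  move=> /andP[oz wz]; rewrite (box_open _ oz) in_cons mem_rcons in_cons /=.
  apply/negP => /or3P[/eqP zx|/eqP zy|zP].
  - by rewrite -zx oz in nx.
  - by rewrite -zy oz in ny.
  - by have /andP[_] := allP wP _ zP; rewrite (negbTE wz).
have offe z : box n z -> ~~ open_box n z -> z != x -> z != y ->
    box n z && (z \notin x :: rcons (A ++ v :: B) y).
  move=> -> oz zx zy; rewrite in_cons mem_rcons in_cons (negbTE zx) (negbTE zy) /=.
  by apply: contra oz => /(allP wP)/andP[].
have sub_wP s : {subset s <= A ++ v :: B} -> all (fun u => open_box n u && w u) s.
  by move=> sP; apply/allP => z /sP/(allP wP).
exists (rcons (rev A) x), (rcons (rev C) x'), (rcons B y), (rcons D y').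
rewrite /= gE; split.
- exists (rev A), x; split=> //; apply: sub_wP => z.
  by rewrite mem_rev mem_cat => ->.
- exists B, y; split=> //; apply: sub_wP => z zB.
  by rewrite mem_cat in_cons zB !orbT.
- split; first by move=> u; apply: dAB.
  by exists x, (A ++ v :: B), y.
- split; last first.
    apply: (part_of_arm pC bsx); rewrite all_rcons; apply/andP; split.
      by apply: offe => //; case/andP: bsx.
    by apply/allP => z; rewrite mem_rev => zC; apply: offg; apply: wQ; rewrite zC.
  exists (rev C), x'; split=> //.
  by apply/allP => z; rewrite mem_rev => zC; apply: wQ; rewrite zC.
- split; last first.
    apply: (part_of_arm pD tsy); rewrite all_rcons; apply/andP; split.
      by apply: offe => //; case/andP: tsy.
    by apply/allP => z zD; apply: offg; apply: wQ; rewrite zD orbT.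
  exists D, y'; split=> //.
  by apply/allP => z zD; apply: wQ; rewrite zD orbT.
Qed.

End Pivotal.

(** * Transfer to the probability space *)

Section Transfer.
Context d (Omega : measurableType d) (R : realType) (P : probability Omega R).
Variables (p : R) (X : Omega -> config).
Hypothesis XP : site_percolation P p X.
Implicit Types (S : seq vertex) (w : config) (v : vertex) (J : {fset vertex}).

Definition over w S (x : config) : config := fun u => if u \in S then x u else w u.

Lemma over_cons w v S x : v \notin S -> over w (v :: S) x = over (upd w v (x v)) S x.
Proof.
move=> vS; apply: funext => u; rewrite /over in_cons /upd.
by case: eqVneq => // ->; rewrite (negbTE vS).
Qed.

Lemma over_cons_state w v S x b : v \notin S -> x v = b ->
  over w (v :: S) x = over (upd w v b) S x.
Proof. by move=> vS <-; apply: over_cons. Qed.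

Let E J : set Omega := \bigcap_(i in [set` J]) [set o | X o i].

Let mX v : measurable [set o | X o v].
Proof. by case: XP. Qed.

Let mE J : measurable (E J).
Proof.
rewrite /E bigcap_fset; apply: (big_ind measurable) => //; exact: measurableI.
Qed.

Let EU v J : E (v |` J)%fset = [set o | X o v] `&` E J.
Proof. by rewrite /E set_fsetU1 bigcap_setU1. Qed.

Let PE v J : v \notin J -> P (E (v |` J)%fset) = (p%:E * P (E J))%E.
Proof.
case: XP => _ PX ind vJ; rewrite /E !ind (big_fsetU1 _ _ vJ) /=.
by rewrite PX.
Qed.

Lemma measurable_site_fun v : measurable_fun setT (fun o => X o v).
Proof.
apply: (measurable_fun_bool true); rewrite setTI.
by rewrite (_ : _ @^-1` _ = [set o | X o v]).
Qed.

Lemma measurable_local (f : config -> R) S w : uniq S ->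
  measurable_fun setT (fun o => f (over w S (X o))).
Proof.
elim: S w => [|v S IH] w; first by move=> _; exact: (@measurable_cst _ _ _ _ setT (f w)).
rewrite [uniq _]/=.
case/andP=> vS uS.
rewrite (_ : (fun o => _) = (fun o => if X o v then f (over (upd w v true) S (X o))
   else f (over (upd w v false) S (X o)))); last first.
  by apply: funext => o; case: ifP => Xv; rewrite (over_cons_state _ vS Xv).
by apply: measurable_fun_ifT; [exact: measurable_site_fun | exact: IH | exact: IH].
Qed.

Lemma measurable_event (g : pred config) S w : uniq S ->
  measurable [set o | g (over w S (X o))].
Proof.
elim: S w => [|v S IH] w /=.
  move=> _; case Eg : (g w).
    by rewrite (_ : [set o | _] = setT) //; apply/seteqP; split=> o //=.
  by rewrite (_ : [set o | _] = set0) //; apply/seteqP; split=> o //=; rewrite -[over _ _ _]/w Eg.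
case/andP=> vS uS.
rewrite (_ : [set o | _] =
  ([set o | X o v] `&` [set o | g (over (upd w v true) S (X o))]) `|`
  ([set o | g (over (upd w v false) S (X o))] `\` [set o | X o v])).
  by apply: measurableU; [apply: measurableI | apply: measurableD]; rewrite ?mX //; apply: IH.
apply/seteqP; split=> o /=.
  by case Xv : (X o v); rewrite (over_cons_state _ vS Xv) => H; [left | right; split].
case=> -[Xv H]; first by rewrite (over_cons_state _ vS Xv).
by rewrite (@over_cons_state _ v S (X o) false vS) //; apply/negbTE/negP.
Qed.

Lemma prob_local_cond (g : pred config) S w J : uniq S -> {in S, forall v, v \notin J} ->
  P (E J `&` [set o | g (over w S (X o))]) =
  (P (E J) * (avg p S (fun w => (g w)%:R) w)%:E)%E.
Proof.
elim: S w J => [|v S IH] w J /=.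
  move=> _ _; case Eg : (g w).
    rewrite mule1 (_ : [set o | _] = setT) ?setIT //.
    by apply/seteqP; split=> o //=.
  rewrite mule0 (_ : [set o | _] = set0) ?setI0 ?measure0 //.
  by apply/seteqP; split=> o //=; rewrite -[over _ _ _]/w Eg.
case/andP=> vS uS SJ.
have vJ : v \notin J by apply: SJ; rewrite mem_head.
have SJ' : {in S, forall u, u \notin J} by move=> u uS'; apply: SJ; rewrite in_cons uS' orbT.
have SvJ : {in S, forall u, u \notin (v |` J)%fset}.
  move=> u uS'; rewrite in_fset1U negb_or SJ' // andbT.
  by apply: contra vS => /eqP <-.
set A := E J `&` _.
pose G b := [set o | g (over (upd w v b) S (X o))].
have mG b : measurable (G b) by apply: measurable_event.
have mA : measurable A by apply: measurableI => //; apply: (measurable_event _ (S := v :: S)); rewrite /= vS.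
have A1 : A `&` [set o | X o v] = E (v |` J)%fset `&` G true.
  rewrite EU; apply/seteqP; split=> o /=.
    by move=> [[EJ H] Xv]; split=> //; rewrite /G /= -(over_cons_state _ vS Xv).
  by move=> [[Xv EJ] H]; split=> //; split=> //; rewrite /= (over_cons_state _ vS Xv).
have A0 : A `\` [set o | X o v] = (E J `&` G false) `\` [set o | X o v].
  apply/seteqP; split=> o /=.
    move=> [[EJ H] Xv]; split=> //; split=> //.
    by rewrite /G /= -(@over_cons_state _ v S (X o) false vS) //; apply/negbTE/negP.
  move=> [[EJ H] Xv]; split=> //; split=> //=.
  by rewrite (@over_cons_state _ v S (X o) false vS) //; apply/negbTE/negP.
have B1 : (E J `&` G false) `&` [set o | X o v] = E (v |` J)%fset `&` G false.
  by rewrite EU setIAC [E J `&` _]setIC.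
have mB : measurable (E J `&` G false) by apply: measurableI.
have finB C : measurable C -> P C \is a fin_num by move=> mC; apply: fin_num_measure.
have H0 : P (E J `&` G false) = (P ((E J `&` G false) `\` [set o | X o v]) +
    P ((E J `&` G false) `&` [set o | X o v]))%E := measureDI P mB (mX v).
have HA : P A = (P (A `\` [set o | X o v]) + P (A `&` [set o | X o v]))%E :=
  measureDI P mA (mX v).
rewrite HA A0 A1.
have IH1 b : P (E (v |` J)%fset `&` G b) =
    (P (E (v |` J)%fset) * (avg p S (fun w => (g w)%:R) (upd w v b))%:E)%E := IH _ _ uS SvJ.
have IH0 b : P (E J `&` G b) =
    (P (E J) * (avg p S (fun w => (g w)%:R) (upd w v b))%:E)%E := IH _ _ uS SJ'.
rewrite B1 IH1 IH0 (PE vJ) in H0; rewrite IH1 (PE vJ).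
have [x Ex] : exists x : R, P (E J) = x%:E by exists (fine (P (E J))); rewrite fineK // finB.
have [y Ey] : exists y : R, P (E J `&` G false `\` [set o | X o v]) = y%:E.
  by exists (fine (P (E J `&` G false `\` [set o | X o v]))); rewrite fineK // finB //; apply: measurableD.
move: H0; rewrite Ex Ey -!EFinM -!EFinD /avg1 => -[H0]; congr EFin.
set t1 := avg _ _ _ (upd w v true); set t0 := avg _ _ _ (upd w v false) in H0 *.
rewrite -/t1; have -> : y = x * t0 - p * x * t0 by rewrite H0; ring.
ring.
Qed.

Lemma prob_local (g : pred config) S w : uniq S ->
  supported S (fun w => (g w)%:R : R) ->
  P [set o | g (X o)] = (avg p S (fun w => (g w)%:R) w)%:E.
Proof.
move=> uS sg; have gE o : g (X o) = g (over w S (X o)).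
  have := sg (X o) (over w S (X o)); rewrite /over.
  have H : {in S, X o =1 (fun u => if u \in S then X o u else w u)} by move=> u ->.
  by move=> /(_ H) /eqP; rewrite eqr_nat; case: (g _); case: (g _).
have := @prob_local_cond g S w fset0 uS (fun v _ => isT).
rewrite /E set_fset0 bigcap_set0 setTI probability_setT mul1e => <-.
by congr (P _); apply/seteqP; split=> o /=; rewrite gE.
Qed.

End Transfer.

Section PivotalCount.
Variable n : nat.
Hypothesis n1 : (1 <= n)%N.
Implicit Types (w : config) (v : vertex).

Definition flips v w : bool :=
  [&& w v, crossed n (upd w v true) & ~~ crossed n (upd w v false)].

Lemma mem_inner_open_box v : (v \in inner n) = open_box n v.
Proof. by rewrite mem_inner // open_box_rect. Qed.

Lemma arm_local (st st' : pred vertex) side v s :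
  (forall u, open_box n u -> st u = st' u) -> arm n st side v s -> arm n st' side v s.
Proof.
move=> H [q [b [-> ps sb aq]]]; exists q, b; split=> //.
by apply: sub_all aq => u /andP[ou su]; rewrite ou -H.
Qed.

Lemma pivotal_local w w' v : {in inner n, w =1 w'} -> pivotal n w v -> pivotal n w' v.
Proof.
move=> ww; have {}ww u : open_box n u -> w u = w' u.
  by rewrite -mem_inner_open_box; apply: ww.
move=> [ov [wv [g1 [g2 [g3 [g4 [a1 a3 [dis lr] [a2 b2] [a4 b4]]]]]]]].
split=> //; split; first by rewrite -ww.
exists g1, g2, g3, g4; split.
- exact: arm_local a1.
- exact: arm_local a3.
- split=> //; case: lr => a [q [b [E pq la rb aq]]]; exists a, q, b; split=> //.
  by apply: sub_all aq => u /andP[ou su]; rewrite ou -ww.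
- by split=> //; apply: arm_local a2 => u ou; rewrite ww.
- by split=> //; apply: arm_local a4 => u ou; rewrite ww.
Qed.

Lemma num_pivotal_local w w' : {in inner n, w =1 w'} -> num_pivotal n w = num_pivotal n w'.
Proof.
move=> ww; rewrite /num_pivotal; congr (#|` fset_set _|).
apply/seteqP; split=> v /=; apply: pivotal_local => // u ui.
by rewrite ww.
Qed.

Lemma crossed_local w w' : {in inner n, w =1 w'} -> crossed n w = crossed n w'.
Proof.
move=> ww; have := crossed_supported rat n1 (w := w) (w' := w') ww.
by move/eqP; rewrite eqr_nat; case: (crossed n w); case: (crossed n w').
Qed.

Lemma flips_local v w w' : {in inner n, w =1 w'} -> w v = w' v -> flips v w = flips v w'.
Proof.
move=> ww vv; rewrite /flips vv; congr [&& _, _ & ~~ _];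
  by apply: crossed_local => u ui; rewrite /upd; case: eqP => // _; apply: ww.
Qed.

Lemma flips_crossed v w : flips v w -> crossed n w.
Proof. by case/and3P=> wv + _; rewrite -{1}wv upd_id. Qed.

Lemma num_flips_le w :
  (\sum_(v <- inner n) flips v w <= num_pivotal n w * crossed n w)%N.
Proof.
have [cw|ncw] := boolP (crossed n w); last first.
  rewrite big1_seq ?muln0 // => v _; case: (boolP (flips v w)) => // /flips_crossed.
  by rewrite (negbTE ncw).
rewrite muln1 -[X in (X <= _)%N](_ : size [seq v <- inner n | flips v w] = _); last first.
  by rewrite size_filter -sum1_count [RHS]big_mkcond /= big_mkcond; apply: eq_bigr => v _; case: flips.
rewrite -(undup_id (filter_uniq _ (uniq_rectl _ _ _ _))) -card_fseq.
apply: fsubset_leq_card; apply/fsubsetP => v.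
have fin : finite_set [set v | pivotal n w v].
  apply: (@sub_finite_set _ _ [set` inner n]); last exact: finite_seq.
  by move=> u [ou _] /=; rewrite mem_inner_open_box.
rewrite in_fset /= mem_filter => /andP[/and3P[wv cv ncv] vi].
rewrite in_fset_set // inE; apply: pivotalP => //; rewrite -?mem_inner_open_box //.
Qed.

End PivotalCount.

Section Expectation.
Context d (Omega : measurableType d) (R : realType) (P : probability Omega R).
Variables (p : R) (X : Omega -> config) (n : nat).
Hypotheses (hp : 0 < p <= 1 / 2) (XP : site_percolation P p X) (n1 : (1 <= n)%N).

Lemma avg_flips v w : v \in inner n ->
  avg p (inner n) (fun w => (flips n v w)%:R) w = p * infl p n v w.
Proof.
move=> vi; rewrite -(avg_absorb1 _ _ _ vi) -avgZ; congr avg; apply: funext => x.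
rewrite /avg1 /flips !upd_same !updK /= mulr0 addr0; congr (_ * _).
have := @crossed_mono n (upd x v false) (upd x v true).
have H u : upd x v false u -> upd x v true u by rewrite /upd; case: eqP.
move=> /(_ H); case: (crossed n (upd x v true)); case: (crossed n (upd x v false)) => //=.
- by rewrite subrr normr0.
- by rewrite subr0 normr1.
- by move=> /(_ isT).
- by rewrite subrr normr0.
Qed.

Lemma expectation_pivotal w :
  ((p * \sum_(v <- inner n) infl p n v w)%:E <=
   'E_P[(fun o => (num_pivotal n (X o))%:R) \* \1_[set o | lr_event n (X o)]])%E.
Proof.
have ui : uniq (inner n) := uniq_rectl _ _ _ _.
have lrE o : \1_[set o | lr_event n (X o)] o = (crossed n (X o))%:R :> R.
  rewrite indicE; congr (_%:R); congr nat_of_bool; apply/idP/idP.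
    by rewrite inE; apply: lr_event_crossed.
  by move=> c; rewrite inE; apply: crossed_lr_event.
have local S (f : config -> R) : uniq S -> (forall w w', {in S, w =1 w'} -> f w = f w') ->
    measurable_fun setT (fun o => f (X o)).
  move=> uS fl; rewrite (_ : (fun o => _) = fun o => f (over w S (X o))).
    exact: (measurable_local XP).
  by apply: funext => o; apply: fl => u uS'; rewrite /over uS'.
rewrite expectation.unlock.
apply: (@le_trans _ _ (\int[P]_o (\sum_(v <- inner n) ((flips n v (X o))%:R : R)%:E))%E).
  rewrite ge0_integral_sum; [|by []| |]; last 2 first.
  - move=> v; apply/measurable_EFinP.
    apply: (local (undup (v :: inner n)) (fun w => (flips n v w)%:R)); first exact: undup_uniq.
    move=> w1 w2 ww; congr (_%:R); congr nat_of_bool; apply: flips_local => //.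
      by move=> u ui'; apply: ww; rewrite mem_undup in_cons ui' orbT.
    by apply: ww; rewrite mem_undup mem_head.
  - by move=> v o _; rewrite lee_fin ler0n.
  rewrite mulr_sumr -sumEFin big_seq [X in (_ <= X)%E]big_seq.
  apply: lee_sum => v vi.
  have sf : supported (inner n) (fun w => (flips n v w)%:R : R).
    by move=> w1 w2 ww; rewrite (flips_local n1 ww) // ww.
  rewrite -(avg_flips w vi) -(prob_local XP w ui sf).
  have mF : measurable [set o | flips n v (X o)].
    rewrite (_ : [set o | _] = [set o | flips n v (over w (inner n) (X o))]).
      exact: (measurable_event XP).
    apply/seteqP; split=> o /=; rewrite (@flips_local _ n1 v (X o) (over w (inner n) (X o))) //;
      by [move=> u ui'; rewrite /over ui' | rewrite /over vi].
  rewrite -[[set o | _]]setIT -(integral_indic P measurableT mF).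
  rewrite le_eqVlt; apply/orP; left; apply/eqP; apply: eq_integral => o _.
  rewrite indicE; congr (_%:E); congr (_%:R); congr nat_of_bool.
  by apply/idP/idP; rewrite inE.
apply: ge0_le_integral => //.
- by move=> o _; apply: sume_ge0 => v _; rewrite lee_fin ler0n.
- rewrite (_ : (fun o => _) = EFin \o (fun o => \sum_(v <- inner n) (flips n v (X o))%:R)).
    apply/measurable_EFinP.
    apply: (local (inner n) (fun w => \sum_(v <- inner n) (flips n v w)%:R)) => // w1 w2 ww.
    by apply: eq_big_seq => v vi; rewrite (flips_local n1 ww) // ww.
  by apply: funext => o; rewrite /= sumEFin.
- apply/measurable_EFinP.
  rewrite [X in measurable_fun _ X](_ : _ = fun o => (num_pivotal n (X o))%:R * (crossed n (X o))%:R).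
    apply: (local (inner n) (fun w => (num_pivotal n w)%:R * (crossed n w)%:R)) => // w1 w2 ww.
    by rewrite (num_pivotal_local n1 ww) (crossed_local n1 ww).
  by apply: funext => o; rewrite /= lrE.
move=> o _; rewrite sumEFin lee_fin /= lrE -natr_sum -natrM ler_nat.
exact: num_flips_le.
Qed.

End Expectation.

Theorem theorem1 (R : realType) (p : R) (hp : 0 < p <= 1 / 2) :
  exists alpha : R, 0 < alpha /\
    forall (d : measure_display) (Omega : measurableType d)
      (P : probability Omega R) (X : Omega -> config),
      site_percolation P p X ->
      forall n : nat, (1 <= n)%N ->
        ((n%:R `^ alpha)%:E <=
         cond_expectation P (fun o => (num_pivotal n (X o))%:R)
           [set o | lr_event n (X o)])%E.
Proof.
have p01 : 0 < 1 - p <= 1 by case/andP: hp => *; apply/andP; split; lra.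
have eps01 n : 0 < (1 - p) ^+ size (inner n) <= 1.
  case/andP: p01 => q0 q1; rewrite exprn_gt0 //=.
  by apply: exprn_ile1 => //; apply: ltW.
have [alpha a0 Ha] := @exponent_choice R 32 (arm_rate R)
  (fun n => (1 - p) ^+ size (inner n)) isT (arm_rate01 R) eps01.
exists alpha; split=> // d Omega P X XP n n1.
pose w : config := fun _ => true.
have F0 := crossing_prob_gt0 hp n1 w.
rewrite /cond_expectation.
have -> : P [set o | lr_event n (X o)] = (crossing_prob p n w)%:E.
  rewrite -(prob_local XP w (uniq_rectl _ _ _ _) (crossed_supported R n1)).
  congr (P _); apply/seteqP; split=> o /=.
    exact: lr_event_crossed.
  exact: crossed_lr_event.
rewrite inver gt_eqF // lee_pdivlMr //.
apply: le_trans (expectation_pivotal XP n1 w).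
rewrite -EFinM lee_fin.
set I := p * _.
have main M : n%:R `^ alpha * M <= (2 * n - 1)%:R ->
    (forall u, u \in inner n -> \sum_(i < 2 * n - 1) revealment p n (nth_column n i) u w <= M) ->
    n%:R `^ alpha * crossing_prob p n w <= I.
  move=> Hn HM; have H := infl_lower hp n1 HM; rewrite -/I in H.
  have I0 : 0 <= I.
    case/andP: hp => h0 h1; apply: mulr_ge0; first exact: ltW.
    apply: sumr_ge0 => u _; apply: avg_ge0 => // ; apply/andP; split; lra.
  have N0 : 0 < (2 * n - 1)%:R :> R by rewrite ltr0n; lia.
  rewrite -(ler_pM2r N0) -mulrA.
  apply: le_trans (ler_wpM2l (powR_ge0 _ _) H) _.
  by rewrite mulrA [I * _]mulrC; apply: ler_wpM2r.
have [n2|n2] := leqP 2 n; last first.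
  have n_eq : n = 1%N by lia.
  apply: (main (2 * n - 1)%:R).
    by rewrite n_eq powR1 mul1r.
  by move=> u _; apply: revealment_sum1.
case: (Ha n n2) => [H|[m H]].
  apply: main H _ => u _; exact: revealment_sum_lt.
apply: main H _ => u ui; exact: revealment_sum_arm.
Qed.
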